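(* Let $\mathcal{M}$ be an atomless von Neumann algebra (not necessarily semi-finite). Then its predual $\mathcal{M}_*$, as a complex Banach space, has the operator Daugavet property.
   Context: A von Neumann algebra is atomless if it has no minimal projections. $\mathcal{M}_*$ is the Banach space of normal linear functionals on $\mathcal{M}$, so $(\mathcal{M}_* )^*=\mathcal{M}$ isometrically. For a complex Banach space $X$ with closed unit ball $B_X$ and unit sphere $S_X$, a slice of $B_X$ is a set $\{x\in B_X:\operatorname{Re}x^*(x)>1-\alpha\}$ with $x^*\in S_{X^*}$ and $\alpha>0$. $X$ has the operator Daugavet property if for every $n\in\mathbb{N}$, all $x_1,\dots,x_n\in S_X$, every slice $S$ of $B_X$, and every $\varepsilon>0$, there exists $x\in S$ such that for every $x_0\in B_X$ there is a bounded (complex-)linear operator $T:X\to X$ with $\|T\|\le1+\varepsilon$, $Tx=x_0$, and $\|Tx_i-x_i\|<\varepsilon$ for $i=1,\dots,n$. *)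

(* Defs.v *)
From HB Require Import structures.
From mathcomp Require Import all_boot all_order all_algebra.
From mathcomp Require Import sesquilinear.
From mathcomp Require Import complex.
From mathcomp Require Import all_classical all_reals all_analysis.

Set Implicit Arguments.
Unset Strict Implicit.
Unset Printing Implicit Defensive.

Import Order.TTheory GRing.Theory Num.Theory.
Import numFieldNormedType.Exports.

Local Open Scope classical_set_scope.
Local Open Scope ring_scope.
Local Open Scope complex_scope.

Section BoundedMaps.
Variables (K : realType) (X Y : normedModType K[i]).

Definition bounded_linear : {pred X -> Y} :=
  mem [set f : X -> Y | linear f /\
                        exists r : K, forall x, `|f x| <= r%:C * `|x|].

Record bounded_map := BoundedMap {
  bounded_fun :> X -> Y;
  bounded_map_subproof : bounded_fun \in bounded_linear }.

HB.instance Definition _ := [isSub for bounded_fun].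
HB.instance Definition _ := [Choice of bounded_map by <:].

Lemma bounded_linear_submod : submod_closed bounded_linear.
Proof.
split.
  rewrite inE; split; first by move=> a u v; rewrite /= scaler0 addr0.
  by exists 0 => x; rewrite mul0r normr0.
move=> a f g; rewrite !inE => -[lf [r Hr]] [lg [s Hs]]; split.
  move=> b u v; rewrite -[LHS]/(a *: f _ + g _) lf lg.
  rewrite -[(a *: f + g) u]/(a *: f u + g u) -[(a *: f + g) v]/(a *: f v + g v).
  by rewrite !scalerDr !scalerA mulrC !addrA; congr (_ + _); rewrite addrAC.
exists (complex.Re `|a| * r + s) => x.
have aE : (complex.Re `|a|)%:C = `|a| by rewrite RRe_real ?normr_real.
rewrite -[(a *: f + g) x]/(a *: f x + g x) (le_trans (ler_normD _ _))//.
rewrite rmorphD rmorphM /= aE mulrDl lerD// normrZ -mulrA.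
by rewrite ler_wpM2l.
Qed.

HB.instance Definition _ :=
  GRing.isSubmodClosed.Build _ _ bounded_linear bounded_linear_submod.
HB.instance Definition _ := [SubChoice_isSubLmodule of bounded_map by <:].

Lemma bounded_map_linear (f : bounded_map) : linear f.
Proof. by have /set_mem[] := bounded_map_subproof f. Qed.

HB.instance Definition _ (f : bounded_map) :=
  GRing.isLinear.Build _ _ _ _ (bounded_fun f) (bounded_map_linear f).

Definition opnorm (f : bounded_map) : K :=
  sup [set complex.Re `|f x| | x in [set x : X | `|x| <= 1]].

Let Re_norm (V : normedModType K[i]) (v : V) : (complex.Re `|v|)%:C = `|v|.
Proof. by rewrite RRe_real ?normr_real. Qed.

Let opnorm_has_sup (f : bounded_map) :
  has_sup [set complex.Re `|f x| | x in [set x : X | `|x| <= 1]].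
Proof.
split; first by exists (complex.Re `|f 0|), 0 => //=; rewrite normr0 ler01.
have /set_mem[_ [r Hr]] := bounded_map_subproof f.
exists `|r| => _ [x /= x1 <-]; rewrite -lecR Re_norm.
rewrite (le_trans (Hr x))// (@le_trans _ _ (`|r|%:C * `|x|))//.
  by rewrite ler_wpM2r// lecR ler_norm.
by rewrite ler_piMr// ler0c.
Qed.

Lemma opnorm_bound (f : bounded_map) x : `|f x| <= (opnorm f)%:C * `|x|.
Proof.
have [->|x0] := eqVneq x 0; first by rewrite linear0 !normr0 mulr0.
have nx : 0 < `|x| by rewrite normr_gt0.
rewrite -ler_pdivrMr// mulrC -[X in X * _]ger0_norm ?invr_ge0//.
rewrite -normrZ -linearZ -(Re_norm (f _)) lecR ub_le_sup//.
  exact: (opnorm_has_sup f).2.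
exists (`|x|^-1 *: x) => //=.
by rewrite normrZ ger0_norm ?invr_ge0// mulVf// gt_eqF.
Qed.

Lemma opnorm_le (f : bounded_map) (r : K) :
  (forall x, `|x| <= 1 -> `|f x| <= r%:C) -> opnorm f <= r.
Proof.
move=> fr; apply: ge_sup; first exact: (opnorm_has_sup f).1.
by move=> _ [x /= x1 <-]; rewrite -lecR Re_norm fr.
Qed.

Lemma opnorm_ge0 (f : bounded_map) : 0 <= opnorm f.
Proof.
apply: ub_le_sup; first exact: (opnorm_has_sup f).2.
by exists 0; rewrite /= ?normr0 ?ler01// linear0 normr0.
Qed.

Let normB (f : bounded_map) : K[i] := (opnorm f)%:C.

Let normBD f g : normB (f + g) <= normB f + normB g.
Proof.
rewrite /normB -rmorphD lecR; apply: opnorm_le => x x1.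
rewrite -[(f + g) x]/(f x + g x) (le_trans (ler_normD _ _))// rmorphD.
by apply: lerD; apply: (le_trans (opnorm_bound _ _));
  rewrite ler_piMr// ler0c opnorm_ge0.
Qed.

Let normBZ_le (a : K[i]) f : normB (a *: f) <= `|a| * normB f.
Proof.
have aE : (complex.Re `|a|)%:C = `|a| by rewrite RRe_real ?normr_real.
rewrite /normB -aE -rmorphM lecR; apply: opnorm_le => x x1.
rewrite -[(a *: f) x]/(a *: f x) normrZ rmorphM /= aE ler_wpM2l//.
by rewrite (le_trans (opnorm_bound _ _))// ler_piMr// ler0c opnorm_ge0.
Qed.

Let normBZ (a : K[i]) f : normB (a *: f) = `|a| * normB f.
Proof.
apply/eqP; rewrite eq_le normBZ_le /=.
have [->|a0] := eqVneq a 0; first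
  by rewrite normr0 mul0r /normB ler0c opnorm_ge0.
rewrite mulrC -ler_pdivlMr ?normr_gt0// mulrC -normfV.
by rewrite (le_trans _ (normBZ_le _ _))// scalerA mulVf// scale1r.
Qed.

Let normB_eq0 f : normB f = 0 -> f = 0.
Proof.
move=> f0; apply: val_inj; apply/funext => x /=.
apply/eqP; rewrite -normr_le0 (le_trans (opnorm_bound f x))//.
by rewrite -/(normB f) f0 mul0r.
Qed.

HB.instance Definition _ :=
  Lmodule_isNormed.Build K[i] bounded_map normBD normBZ normB_eq0.

Lemma bounded_map_normE (f : bounded_map) : `|f| = (opnorm f)%:C.
Proof. by []. Qed.

End BoundedMaps.

Definition continuous_dual (K : realType) (X : normedModType K[i]) : Type :=
  bounded_map X K[i]^o.

HB.instance Definition _ (K : realType) (X : normedModType K[i]) :=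
  NormedModule.on (continuous_dual X).

Section Subspaces.
Variables (K : realType) (V : normedModType K[i]) (S : submodClosed V).

Record normed_subspace := NormedSubspace {
  subspace_val :> V;
  normed_subspace_subproof : subspace_val \in S }.

HB.instance Definition _ := [isSub for subspace_val].
HB.instance Definition _ := [Choice of normed_subspace by <:].
HB.instance Definition _ := [SubChoice_isSubLmodule of normed_subspace by <:].

Let normS (u : normed_subspace) : K[i] := `|subspace_val u|.

Let normSD u v : normS (u + v) <= normS u + normS v.
Proof. exact: ler_normD. Qed.

Let normSZ (a : K[i]) u : normS (a *: u) = `|a| * normS u.
Proof. exact: normrZ. Qed.

Let normS_eq0 u : normS u = 0 -> u = 0.
Proof. by move=> /normr0_eq0 u0; apply: val_inj. Qed.

HB.instance Definition _ :=
  Lmodule_isNormed.Build K[i] normed_subspace normSD normSZ normS_eq0.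

Lemma normed_subspace_normE (u : normed_subspace) : `|u| = `|subspace_val u|.
Proof. by []. Qed.

End Subspaces.

Section OperatorDaugavet.
Variables (K : realType) (X : normedModType K[i]).

Definition ball_slice (f : continuous_dual X) (alpha : K) : set X :=
  [set x | `|x| <= 1 /\ 1 - alpha < complex.Re (f x)].

(* The property only involves the norm, so completeness of X is not needed to
   state it. The norm of K[i] is valued in K[i], hence the casts %:C. *)
Definition operator_daugavet : Prop :=
  forall (n : nat) (x : 'I_n -> X), (forall i, `|x i| = 1) ->
  forall (f : continuous_dual X) (alpha : K), `|f| = 1 -> 0 < alpha ->
  forall eps : K, 0 < eps ->
  exists2 y, ball_slice f alpha y &
    forall x0 : X, `|x0| <= 1 ->
    exists T : bounded_map X X,
      [/\ `|T| <= (1 + eps)%:C, T y = x0 &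
          forall i, `|T (x i) - x i| < eps%:C].

End OperatorDaugavet.

(* The inner product is linear in its first argument, conjugate-linear in the
   second, and induces the norm for which H is complete. *)
HB.mixin Record CompleteNormedModule_isHilbert (K : realType) H
    & CompleteNormedModule K[i] H := {
  inner : {dot H for @Num.conj K[i]} ;
  innerxx : forall x : H, inner x x = `|x| ^+ 2 }.

#[short(type="hilbertType")]
HB.structure Definition Hilbert (K : realType) :=
  { H of CompleteNormedModule K[i] H & CompleteNormedModule_isHilbert K H }.

Section VonNeumann.
Variables (K : realType) (H : hilbertType K).

Definition adjoint (a b : bounded_map H H) : Prop :=
  forall x y : H, inner (a x) y = inner x (b y).

Definition commutant (A : set (bounded_map H H)) : set (bounded_map H H) :=
  [set b | forall a, A a -> forall x, b (a x) = a (b x)].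

(* M'' = M already makes M a unital subalgebra (see vn_submod for linearity). *)
Record vonNeumannAlgebra := VonNeumannAlgebra {
  vn_set : set (bounded_map H H);
  vn_star : forall a, vn_set a -> exists2 b, vn_set b & adjoint a b;
  vn_bicommutant : commutant (commutant vn_set) = vn_set }.

Definition projection (p : bounded_map H H) : Prop :=
  (forall x, p (p x) = p x) /\ adjoint p p.

(* On projections: q <= p iff the range of q is contained in that of p. *)
Definition operator_le (a b : bounded_map H H) : Prop :=
  forall x : H, inner (a x) x <= inner (b x) x.

Definition minimal_projection (M : vonNeumannAlgebra) (p : bounded_map H H) :=
  [/\ vn_set M p, projection p, p != 0 &
      forall q, vn_set M q -> projection q -> operator_le q p ->
      q = 0 \/ q = p].

Definition atomless (M : vonNeumannAlgebra) : Prop :=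
  forall p, ~ minimal_projection M p.

Section Predual.
Variable M : vonNeumannAlgebra.

Definition vn_mem : {pred bounded_map H H} := mem (vn_set M).

Lemma vn_submod : submod_closed vn_mem.
Proof.
rewrite /vn_mem -vn_bicommutant; split.
  by rewrite inE => a _ x; rewrite -[LHS]/(0 : H) -[RHS]/(a 0) linear0.
move=> c a b; rewrite !inE => Ha Hb d Hd x.
rewrite -[LHS]/(c *: a (d x) + b (d x)) -[(c *: a + b) x]/(c *: a x + b x).
by rewrite linearP Ha// Hb.
Qed.

HB.instance Definition _ := GRing.isSubmodClosed.Build _ _ vn_mem vn_submod.

Definition vn_elt : Type := normed_subspace vn_mem.
HB.instance Definition _ := NormedModule.on vn_elt.

Record l2seq := L2Seq {
  l2seq_fun :> nat -> H;
  l2seqP : cvgn (series (fun n => `|l2seq_fun n| ^+ 2) : nat -> K[i]^o) }.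

(* The sigma-weak (ultraweak) topology on M is the coarsest one making every
   a |-> \sum_n <a (xi n), eta n>, with xi, eta square-summable, continuous:
   the initial topology of the map below into the product of copies of K[i]. *)
Definition sigma_weak_eval (a : vn_elt) : {ptws (l2seq * l2seq) -> K[i]^o} :=
  fun p => limn (series (fun n => inner (subspace_val a (p.1 n)) (p.2 n))
                 : nat -> K[i]^o).

(* Normal functionals are the sigma-weakly continuous ones; these are
   automatically bounded, so taking them in the dual of M loses nothing. *)
Definition normal_functional : {pred continuous_dual vn_elt} :=
  mem [set f : continuous_dual vn_elt |
        continuous (f : initial_topology sigma_weak_eval -> K[i]^o)].

Lemma normal_functional_submod : submod_closed normal_functional.
Proof.
split.
  rewrite inE => x.
  by rewrite -[bounded_fun 0]/(cst (0 : K[i]^o)); apply: cst_continuous.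
move=> c f g /set_mem fc /set_mem gc; apply/mem_set => x.
have FF : Filter (nbhs x).
  exact: (@nbhs_filter (initial_topology sigma_weak_eval)).
have cfc := @cvgZl_tmp _ K[i]^o _ _ FF c _ _ (fc x).
exact: (@cvgD _ K[i]^o _ _ FF _ _ _ _ cfc (gc x)).
Qed.

HB.instance Definition _ := GRing.isSubmodClosed.Build _ _
  normal_functional normal_functional_submod.

Definition predual : Type := normed_subspace normal_functional.
HB.instance Definition _ := NormedModule.on predual.

End Predual.
End VonNeumann.

(* Main.v *)
From HB Require Import structures.
Require Import Defs.
From mathcomp Require Import all_boot all_order all_algebra.
From mathcomp Require Import sesquilinear complex.
From mathcomp Require Import all_classical all_reals all_analysis.
From mathcomp Require Import ring lra.

(** The predual has the operator Daugavet property because an atomless algebra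
    contains nonzero projections that are negligible for any finite set of normal
    functionals, even inside the spectral subspace where a given operator almost
    attains its norm.

    A functional [f] of norm one on the predual is evaluation at some [b] of norm
    one in the algebra ([predual_dual_repr]). For [s < 1] close to 1 there is a
    nonzero projection [e] of the algebra such that [b] shrinks no vector of its
    range by more than the factor [s] ([spectral_projection]). Since there are no
    minimal projections, [e] can be halved repeatedly, and so it dominates a
    nonzero projection [p] as small as desired on any finite set of vectors
    ([small_projection]). The range projection [q] of [b p] is then small as well
    ([left_support]), because [b] is bounded below on the range of [p].

    Let [xi] be a unit vector in the range of [p], and [be = nr (b xi)], which is
    at least [s]. The vector functional [y] of [xi] and [b xi / be] takes the value
    [be] at [b], so it lies in the slice. Given [x0], put
      [T z = z ((1 - q) . (1 - p)) + (z (b p) / be) x0].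
    Then [T y = x0], since [1 - p] kills [xi] and [y (b p) = be]. The operators
    [(1 - q) a (1 - p)] and [b p = q b p] sit in complementary corners, hence their
    sum has the maximum of their norms; dually, [z ((1 - q) . (1 - p))] and
    [z (b p)] share the norm of [z] ([corner_additive]), and the norm of [T] is at
    most [1 / be] ([daugavet_operator]). Finally [T] hardly moves the given
    functionals: each is close in norm to a finite sum of vector functionals
    ([normal_approx]), and on the vectors of these sums [p] and [q] are small
    ([corner_close]).

    The spectral projection is obtained without spectral theory, from the modulus
    of a self-adjoint operator, itself a limit of an elementary iteration
    ([contraction_root]). Projections are shown to belong to the algebra by the
    bicommutant property: it suffices that the subspace be invariant under the
    commutant ([vn_projector]). *)

Set Implicit Arguments.
Unset Strict Implicit.
Unset Printing Implicit Defensive.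

Import Order.TTheory GRing.Theory Num.Theory.
Import numFieldNormedType.Exports.

Local Open Scope classical_set_scope.
Local Open Scope ring_scope.
Local Open Scope complex_scope.

(** * Real-valued norms and convergence of sequences *)

Section RealNorm.
Variable K : realType.

(** The norm of a space over [K[i]] takes values in [K[i]]. Estimates with several
    terms are done on its real part, where [lra] and real suprema apply. *)
Definition nr (V : normedModType K[i]) (v : V) : K := complex.Re `|v|.
Arguments nr : simpl never.

Variable V : normedModType K[i].
Implicit Types v w : V.

Lemma nrE v : (nr v)%:C = `|v|.
Proof. by rewrite /nr RRe_real ?normr_real. Qed.

Lemma nr_ge0 v : 0 <= nr v.
Proof. by rewrite -ler0c nrE. Qed.

Lemma nrD v w : nr (v + w) <= nr v + nr w.
Proof. by rewrite -lecR rmorphD /= !nrE ler_normD. Qed.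

Lemma nrZ (c : K[i]) v : nr (c *: v) = nr (c : K[i]^o) * nr v.
Proof. by apply: (@complexI K); rewrite rmorphM /= !nrE normrZ. Qed.

Lemma nrN v : nr (- v) = nr v.
Proof. by rewrite /nr normrN. Qed.

Lemma nrB v w : nr (v - w) <= nr v + nr w.
Proof. by rewrite -(nrN w) nrD. Qed.

Lemma nr_distC v w : nr (v - w) = nr (w - v).
Proof. by rewrite -nrN opprB. Qed.

Lemma nr0 : nr (0 : V) = 0.
Proof. by rewrite /nr normr0. Qed.

Lemma nr_eq0 v : nr v = 0 -> v = 0.
Proof. by move=> v0; apply/normr0_eq0; rewrite -nrE v0. Qed.

Lemma nr_gt0 v : v != 0 -> 0 < nr v.
Proof.
by move=> v0; rewrite lt_neqAle nr_ge0 andbT; apply: contra_neq v0 => /esym/nr_eq0.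
Qed.

Lemma nr_sum (I : Type) (r : seq I) (F : I -> V) :
  nr (\sum_(i <- r) F i) <= \sum_(i <- r) nr (F i).
Proof.
elim/big_ind2: _ => [|x a y b xa yb|//]; first by rewrite nr0.
by rewrite (le_trans (nrD _ _)) ?lerD.
Qed.

Lemma nr_le v (r : K) : (`|v| <= r%:C) = (nr v <= r).
Proof. by rewrite -nrE lecR. Qed.

Lemma nr_lt v (r : K) : (`|v| < r%:C) = (nr v < r).
Proof. by rewrite -nrE ltcR. Qed.

Lemma nr_small v (C : K) : (forall e : K, 0 < e -> nr v <= C * e) -> v = 0.
Proof.
move=> h; apply: nr_eq0; apply/eqP; rewrite eq_le nr_ge0 andbT.
apply/ler_addgt0Pl => e e0; rewrite addr0.
have [C0|C0] := leP C 0.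
  apply: (le_trans (h _ e0)); apply: (@le_trans _ _ 0); last exact: ltW.
  by rewrite mulr_le0_ge0 // ltW.
by apply: (le_trans (h _ (divr_gt0 e0 C0))); rewrite mulrC divfK ?gt_eqF.
Qed.

End RealNorm.
Arguments nr : simpl never.

Section ComplexModulus.
Variable K : realType.

Lemma nr_real (r : K) : 0 <= r -> nr (r%:C : K[i]^o) = r.
Proof. by move=> r0; rewrite /nr ger0_norm ?ler0c. Qed.

Lemma nr1 : nr (1 : K[i]^o) = 1.
Proof. by rewrite /nr normr1. Qed.

Lemma nrM (c d : K[i]) : nr (c * d : K[i]^o) = nr (c : K[i]^o) * nr (d : K[i]^o).
Proof. by apply: (@complexI K); rewrite rmorphM /= !nrE normrM. Qed.

Lemma Re_nr (c : K[i]) : complex.Re c <= nr (c : K[i]^o).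
Proof.
by rewrite -lecR nrE (le_trans _ (normc_ge_Re c)) // lecR ler_norm.
Qed.

Lemma nr_conj (c : K[i]) : nr ((c^*)%R : K[i]^o) = nr (c : K[i]^o).
Proof. by rewrite /nr normcJ. Qed.

Lemma conj_real (r : K) : ((r%:C)^*)%R = r%:C.
Proof. exact: conjc_real. Qed.

Lemma nr_ReIm (c : K[i]) :
  nr (c : K[i]^o) <= `|complex.Re c| + `|complex.Im c|.
Proof.
rewrite -lecR nrE {1}(complexE c) (le_trans (ler_normD _ _)) //.
rewrite rmorphD /= lerD // ?normrM ?normc_def /= ?expr0n /= ?addr0 ?add0r.
  by rewrite sqrtr_sqr lexx.
by rewrite expr1n sqrtr1 mul1r sqrtr_sqr lexx.
Qed.

Lemma Im_nr (c : K[i]) : `|complex.Im c| <= nr (c : K[i]^o).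
Proof.
rewrite -lecR nrE normc_def lecR -sqrtr_sqr ler_sqrt ?addr_ge0 ?sqr_ge0//.
by rewrite lerDr sqr_ge0.
Qed.

Lemma absRe_nr (c : K[i]) : `|complex.Re c| <= nr (c : K[i]^o).
Proof. by rewrite -lecR nrE normc_ge_Re. Qed.

Lemma phase (c : K[i]) : exists2 u : K[i], nr (u : K[i]^o) = 1 &
  u * c = (nr (c : K[i]^o))%:C.
Proof.
have [->|c0] := eqVneq c 0.
  by exists 1; rewrite ?nr1 // mulr0 nr0.
have nc0 : 0 < nr (c : K[i]^o) by exact: nr_gt0.
exists ((c^*)%R / (nr (c : K[i]^o))%:C).
  rewrite nrM nr_conj -fmorphV /= nr_real ?invr_ge0 ?ltW //.
  by rewrite divff ?gt_eqF.
rewrite mulrAC [(_^*)%R * c]mulrC -sqr_normc -[`|c|]/(`|c : K[i]^o|) -nrE expr2.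
by rewrite mulfK // -(rmorph0 (real_complex K)) (inj_eq (@complexI K)) gt_eqF.
Qed.

End ComplexModulus.

Section Limits.
Variable K : realType.

(** The epsilon-N form of convergence: the estimates below produce explicit ranks,
    and [lim_toP] exchanges it for convergence of filters. *)
Definition lim_to (V : normedModType K[i]) (u : nat -> V) (l : V) :=
  forall e : K, 0 < e -> exists N, forall n, (N <= n)%N -> nr (u n - l) < e.

Definition cauchy_nr (V : normedModType K[i]) (u : nat -> V) :=
  forall e : K, 0 < e ->
    exists N, forall m n, (N <= n <= m)%N -> nr (u m - u n) < e.

Lemma posC (e : K[i]) : 0 < e -> exists2 r : K, 0 < r & e = r%:C.
Proof.
move=> e0; have eE : (complex.Re e)%:C = e by rewrite RRe_real // gtr0_real.
by exists (complex.Re e); rewrite // -ltcR eE.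
Qed.

Lemma lim_toP (V : normedModType K[i]) (u : nat -> V) (l : V) :
  lim_to u l <-> u @ \oo --> l.
Proof.
split=> [h|h e e0].
  apply/cvgrPdist_lt => e /posC[r r0 ->]; have [N hN] := h _ r0.
  by exists N => // n /= Nn; rewrite distrC -nrE ltcR hN.
have /cvgrPdist_lt/(_ e%:C) := h.
rewrite ltcR => /(_ e0)[N _ hN]; exists N => n Nn.
by rewrite -nr_lt distrC; apply: hN.
Qed.

Lemma lim_to_lim (V : normedModType K[i]) (u : nat -> V) (l : V) :
  lim_to u l -> limn u = l.
Proof. by move=> /lim_toP h; apply: (cvg_lim _ h); exact: norm_hausdorff. Qed.

Lemma lim_to_uniq (V : normedModType K[i]) (u : nat -> V) (l m : V) :
  lim_to u l -> lim_to u m -> l = m.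
Proof. by move=> /lim_to_lim <- /lim_to_lim <-. Qed.

Lemma lim_to_cauchy (V : normedModType K[i]) (u : nat -> V) (l : V) :
  lim_to u l -> cauchy_nr u.
Proof.
move=> h e e0; have [N hN] := h _ (divr_gt0 e0 (ltr0n _ 2)).
exists N => m n /andP[Nn nm].
have -> : u m - u n = (u m - l) - (u n - l) by rewrite opprB addrA subrK.
rewrite (le_lt_trans (nrB _ _)) // [ltRHS](splitr e) ltrD ?hN //.
exact: leq_trans nm.
Qed.

Lemma cauchy_lim (V : completeNormedModType K[i]) (u : nat -> V) :
  cauchy_nr u -> exists l, lim_to u l.
Proof.
move=> h; suff : cvgn u by move=> hu; exists (limn u); apply/lim_toP.
apply/cauchy_cvgP/cauchy_exP => _ /posC[r r0 ->].
have [N hN] := h _ r0; exists (u N), N => // n /= Nn.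
by rewrite -ball_normE /ball_ /= -nrE ltcR nr_distC hN // leqnn.
Qed.

Lemma cauchy_lim_real (u : nat -> K) :
  (forall e : K, 0 < e ->
    exists N, forall m n, (N <= n <= m)%N -> `|u m - u n| < e) ->
  exists l, forall e : K, 0 < e ->
    exists N, forall n, (N <= n)%N -> `|u n - l| < e.
Proof.
move=> h; have hu : cvgn (u : nat -> K^o).
  apply/cauchy_cvgP/cauchy_exP => r r0.
  have [N hN] := h _ r0; exists (u N), N => // n /= Nn.
  by rewrite -ball_normE /ball_ /= distrC hN // leqnn.
exists (limn (u : nat -> K^o)) => e e0.
have /cvgrPdist_lt/(_ e e0)[N _ hN] := hu.
by exists N => n Nn; rewrite distrC hN.
Qed.

(** Completeness of [K[i]] reduces to that of [K], through real and imaginary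
    parts. *)
Lemma cauchy_limC (u : nat -> K[i]^o) :
  cauchy_nr u -> exists l : K[i]^o, lim_to u l.
Proof.
move=> h.
have [a ha] : exists l, forall e : K, 0 < e ->
    exists N, forall n, (N <= n)%N -> `|complex.Re (u n) - l| < e.
  apply: cauchy_lim_real => e /h[N hN]; exists N => m n /hN.
  by apply: le_lt_trans; rewrite -raddfB absRe_nr.
have [b hb] : exists l, forall e : K, 0 < e ->
    exists N, forall n, (N <= n)%N -> `|complex.Im (u n) - l| < e.
  apply: cauchy_lim_real => e /h[N hN]; exists N => m n /hN.
  by apply: le_lt_trans; rewrite -raddfB Im_nr.
exists (a +i* b) => e e0.
have [N1 h1] := ha _ (divr_gt0 e0 (ltr0n _ 2)).
have [N2 h2] := hb _ (divr_gt0 e0 (ltr0n _ 2)).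
exists (maxn N1 N2) => n; rewrite geq_max => /andP[n1 n2].
rewrite (le_lt_trans (nr_ReIm _)) // [ltRHS](splitr e).
by rewrite !raddfB /= ltrD ?h1 ?h2.
Qed.

End Limits.

(** * Bounded maps and Hilbert space geometry *)

Section BoundedMapConstruction.
Variables (K : realType) (X Y : normedModType K[i]).

Lemma bounded_linear_mk (f : X -> Y) (C : K) :
  linear f -> (forall x, nr (f x) <= C * nr x) -> f \in @bounded_linear K X Y.
Proof.
move=> lf hf; rewrite inE; split=> //; exists C => x.
by rewrite -!nrE -rmorphM lecR.
Qed.

Definition mkbm (f : X -> Y) (C : K) (lf : linear f)
    (hf : forall x, nr (f x) <= C * nr x) : bounded_map X Y :=
  BoundedMap (bounded_linear_mk lf hf).

Implicit Types a b : bounded_map X Y.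

Lemma bmD a b x : (a + b) x = a x + b x.
Proof. by []. Qed.

Lemma bmB a b x : (a - b) x = a x - b x.
Proof. by []. Qed.

Lemma bmZ (c : K[i]) a x : (c *: a) x = c *: a x.
Proof. by []. Qed.

Lemma bm0 x : (0 : bounded_map X Y) x = 0.
Proof. by []. Qed.

Lemma bm_addr a x y : a (x + y) = a x + a y.
Proof. exact: raddfD. Qed.

Lemma bm_subr a x y : a (x - y) = a x - a y.
Proof. exact: raddfB. Qed.

Lemma bm_scaler a (c : K[i]) x : a (c *: x) = c *: a x.
Proof. exact: linearZ. Qed.

Lemma bm_0r a : a 0 = 0.
Proof. exact: raddf0. Qed.

Lemma bm_ext a b : (forall x, a x = b x) -> a = b.
Proof. by move=> h; apply: val_inj; apply/funext. Qed.

Lemma nr_opnorm a : nr a = opnorm a.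
Proof. by rewrite /nr bounded_map_normE. Qed.

Lemma bm_nr a x : nr (a x) <= nr a * nr x.
Proof. by rewrite nr_opnorm -lecR rmorphM /= !nrE opnorm_bound. Qed.

Lemma bm_le a (r : K) : 0 <= r -> (forall x, nr (a x) <= r * nr x) -> nr a <= r.
Proof.
move=> r0 h; rewrite nr_opnorm; apply: opnorm_le => x.
by rewrite nr_le -(rmorph1 (real_complex K)) nr_le => x1;
  rewrite (le_trans (h x)) // ler_piMr.
Qed.

(** Turns a lower bound on the norm of an operator into a vector on which it is
    visible. *)
Lemma bm_attain a (r : K) : 0 <= r -> r < nr a -> exists x, r * nr x < nr (a x).
Proof.
move=> r0 ra; apply: contrapT => h; have : nr a <= r; last by rewrite leNgt ra.
by apply: bm_le => // x; rewrite leNgt; apply/negP => hx; apply: h; exists x.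
Qed.

Lemma bm_lim a (u : nat -> X) (l : X) :
  lim_to u l -> lim_to (fun n => a (u n)) (a l).
Proof.
move=> h e e0; have a1 : 0 < nr a + 1 by rewrite ltr_wpDl ?nr_ge0.
have [N hN] := h _ (divr_gt0 e0 a1); exists N => n /hN {}hN.
rewrite -raddfB (le_lt_trans (bm_nr _ _)) //.
rewrite (@le_lt_trans _ _ ((nr a + 1) * nr (u n - l))) //.
  by rewrite ler_wpM2r ?nr_ge0 ?lerDl.
by rewrite mulrC -ltr_pdivlMr.
Qed.

End BoundedMapConstruction.

Section Composition.
Variables (K : realType) (X Y Z : normedModType K[i]).

Lemma bcomp_subproof (a : bounded_map Y Z) (b : bounded_map X Y) :
  (a \o b : X -> Z) \in @bounded_linear K X Z.
Proof.
apply: (@bounded_linear_mk _ _ _ _ (nr a * nr b)) => [c x y|x] /=.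
  by rewrite !linearP.
by rewrite (le_trans (bm_nr _ _)) // -mulrA ler_wpM2l ?nr_ge0 ?bm_nr.
Qed.

Definition bcomp a b : bounded_map X Z := BoundedMap (bcomp_subproof a b).

Lemma bcompE a b x : bcomp a b x = a (b x).
Proof. by []. Qed.

End Composition.

Section Identity.
Variables (K : realType) (X : normedModType K[i]).

Lemma bid_subproof : (id : X -> X) \in @bounded_linear K X X.
Proof. by apply: (@bounded_linear_mk _ _ _ _ 1) => [c x y|x] //; rewrite mul1r. Qed.

Definition bid : bounded_map X X := BoundedMap bid_subproof.

Lemma bidE x : bid x = x.
Proof. by []. Qed.

End Identity.
Arguments bid {K X}.

Section HilbertGeometry.
Variables (K : realType) (H : hilbertType K).
Implicit Types (x y z : H) (c : K[i]).

Lemma ipDl x y z : inner (x + y) z = inner x z + inner y z.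
Proof. exact: linearDl. Qed.
Lemma ipBl x y z : inner (x - y) z = inner x z - inner y z.
Proof. exact: linearBl. Qed.
Lemma ipZl c x z : inner (c *: x) z = c * inner x z.
Proof. exact: linearZl_LR. Qed.
Lemma ip0l z : inner 0 z = 0.
Proof. exact: linear0l. Qed.
Lemma ipC x y : inner x y = ((inner y x)^*)%R.
Proof. by rewrite hermC /= mul1r. Qed.
Lemma ipDr x y z : inner x (y + z) = inner x y + inner x z.
Proof. exact: linearDr. Qed.
Lemma ipBr x y z : inner x (y - z) = inner x y - inner x z.
Proof. exact: linearBr. Qed.
Lemma ipZr c x y : inner x (c *: y) = (c^*)%R * inner x y.
Proof. by rewrite ipC ipZl rmorphM /= -ipC. Qed.
Lemma ip0r z : inner z 0 = 0.
Proof. by rewrite ipC ip0l conjC0. Qed.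

Lemma ipxx x : inner x x = (nr x ^+ 2)%:C.
Proof. by rewrite innerxx -nrE rmorphXn. Qed.

Definition rip x y : K := complex.Re (inner x y).

Lemma ripC x y : rip x y = rip y x.
Proof. by rewrite /rip ipC; case: (inner y x). Qed.
Lemma ripDl x y z : rip (x + y) z = rip x z + rip y z.
Proof. by rewrite /rip ipDl raddfD. Qed.
Lemma ripBl x y z : rip (x - y) z = rip x z - rip y z.
Proof. by rewrite /rip ipBl raddfB. Qed.
Lemma ripBr x y z : rip x (y - z) = rip x y - rip x z.
Proof. by rewrite ripC ripBl !(ripC x). Qed.
Lemma ripDr x y z : rip x (y + z) = rip x y + rip x z.
Proof. by rewrite ripC ripDl !(ripC x). Qed.
Lemma ripZl (r : K) x y : rip (r%:C *: x) y = r * rip x y.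
Proof. by rewrite /rip ipZl; case: (inner x y) => a b /=; rewrite mul0r subr0. Qed.
Lemma ripZr (r : K) x y : rip x (r%:C *: y) = r * rip x y.
Proof. by rewrite ripC ripZl ripC. Qed.
Lemma ripxx x : rip x x = nr x ^+ 2.
Proof. by rewrite /rip ipxx. Qed.

Lemma nrsqD x y : nr (x + y) ^+ 2 = nr x ^+ 2 + nr y ^+ 2 + 2 * rip x y.
Proof. by rewrite -!ripxx ripDl !ripDr (ripC y x); ring. Qed.
Lemma nrsqB x y : nr (x - y) ^+ 2 = nr x ^+ 2 + nr y ^+ 2 - 2 * rip x y.
Proof. by rewrite -!ripxx ripBl !ripBr (ripC y x); ring. Qed.

Lemma nrsq_orth x y : inner x y = 0 -> nr (x + y) ^+ 2 = nr x ^+ 2 + nr y ^+ 2.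
Proof. by move=> h; rewrite nrsqD /rip h mulr0 addr0. Qed.

Lemma nrZr (r : K) x : 0 <= r -> nr (r%:C *: x) = r * nr x.
Proof. by move=> r0; rewrite nrZ nr_real. Qed.

Lemma nrsq_le (a b : K) : 0 <= b -> a ^+ 2 <= b ^+ 2 -> a <= b.
Proof.
move=> b0 h; have [a0|/ltW a0] := leP 0 a; last exact: le_trans b0.
by rewrite -(@ler_pXn2r _ 2) ?nnegrE.
Qed.

Lemma rip_le x y : rip x y <= nr x * nr y.
Proof.
have [->|y0] := eqVneq y 0; first by rewrite ripC /rip ip0l nr0 mulr0.
have ny : 0 < nr y by exact: nr_gt0.
have := sqr_ge0 (nr ((nr y)%:C *: x - (nr x)%:C *: y)).
rewrite nrsqB !nrZr ?nr_ge0 // ripZl ripZr => h.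
have [x0|x0] := eqVneq x 0; first by rewrite x0 /rip ip0l nr0 mul0r.
have nx : 0 < nr x by exact: nr_gt0.
rewrite -(ler_pM2l (mulr_gt0 nx ny)); nra.
Qed.

Lemma ip_le x y : nr (inner x y : K[i]^o) <= nr x * nr y.
Proof.
have [u u1 hu] := phase (inner x y).
have -> : nr (inner x y : K[i]^o) = rip (u *: x) y by rewrite /rip ipZl hu.
by rewrite (le_trans (rip_le _ _)) // nrZ u1 mul1r.
Qed.

Lemma ip_ext x y : (forall z, inner x z = inner y z) -> x = y.
Proof.
move=> h; apply/eqP; rewrite -subr_eq0; apply/eqP/nr_eq0/eqP.
by rewrite -sqrf_eq0 -ripxx /rip ipBl h subrr.
Qed.

Lemma ip_ext0 x : inner x x = 0 -> x = 0.
Proof.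
by move=> h; apply/nr_eq0/eqP; rewrite -sqrf_eq0 -ripxx /rip h.
Qed.

Lemma ip_lim (u : nat -> H) x y : lim_to u x ->
  lim_to (fun n => inner (u n) y : K[i]^o) (inner x y).
Proof.
move=> h e e0; have a1 : 0 < nr y + 1 by rewrite ltr_wpDl ?nr_ge0.
have [N hN] := h _ (divr_gt0 e0 a1); exists N => n /hN {}hN.
rewrite -ipBl (le_lt_trans (ip_le _ _)) //.
rewrite (@le_lt_trans _ _ (nr (u n - x) * (nr y + 1))) //.
  by rewrite ler_wpM2l ?nr_ge0 ?lerDl.
by rewrite -ltr_pdivlMr.
Qed.

End HilbertGeometry.

(** * Orthogonal projections *)

Section OrthogonalProjection.
Variables (K : realType) (H : hilbertType K).
Implicit Types (L : set H) (x y z w : H) (p : bounded_map H H).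

Definition lin_subspace L := L 0 /\ forall (c : K[i]) x y, L x -> L y -> L (c *: x + y).

(** Being approximable by [L], without reference to the topology: every use of a
    closure below is an estimate that passes from [L] to such points. *)
Definition in_closure L x := forall e : K, 0 < e -> exists2 l, L l & nr (x - l) < e.

Lemma in_closure_sub L x : L x -> in_closure L x.
Proof. by move=> Lx e e0; exists x; rewrite // subrr nr0. Qed.

Lemma subspace_closure L : lin_subspace L -> lin_subspace (in_closure L).
Proof.
move=> [L0 hL]; split; first exact: in_closure_sub.
move=> c x y hx hy e e0; have c1 : 0 < nr (c : K[i]^o) + 1 by rewrite ltr_wpDl ?nr_ge0.
have [l Ll xl] := hx _ (divr_gt0 (divr_gt0 e0 (ltr0n _ 2)) c1).
have [m Lm ym] := hy _ (divr_gt0 e0 (ltr0n _ 2)).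
exists (c *: l + m); first exact: hL.
have -> : c *: x + y - (c *: l + m) = c *: (x - l) + (y - m).
  by rewrite scalerBr opprD addrACA.
rewrite (le_lt_trans (nrD _ _)) // [ltRHS](splitr e) ltr_leD ?(ltW ym) // nrZ.
rewrite (@le_lt_trans _ _ ((nr (c : K[i]^o) + 1) * nr (x - l))) //.
  by rewrite ler_wpM2r ?nr_ge0 ?lerDl.
by rewrite mulrC -ltr_pdivlMr.
Qed.

Lemma orth_closure L x y :
  (forall l, L l -> inner l y = 0) -> in_closure L x -> inner x y = 0.
Proof.
move=> h hx; apply: (@nr_small _ K[i]^o _ (nr y)) => e /hx[l Ll xl].
have -> : inner x y = inner (x - l) y by rewrite ipBl (h l) // subr0.
by rewrite (le_trans (ip_le _ _)) // mulrC ler_wpM2l ?nr_ge0 ?ltW.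
Qed.

Lemma nat_inv_lt (e : K) : 0 < e -> exists N : nat, N.+1%:R^-1 < e.
Proof.
move=> e0; exists (Num.truncn e^-1); rewrite invf_plt ?posrE //.
exact: truncnS_gt.
Qed.

(** The derivative of [t |-> nr (v - t u x) ^ 2] at [t = 0] must vanish; the phase
    [u] makes [u * inner x v] real, so that this derivative sees its full modulus. *)
Lemma nearest_orth x v L : lin_subspace L ->
  (forall l, L l -> nr v <= nr (v - l)) -> L x -> inner v x = 0.
Proof.
move=> [L0 hL] hv Lx; have [u u1 hu] := phase (inner x v).
suff h : nr (inner x v : K[i]^o) <= 0.
  rewrite ipC; suff -> : inner x v = 0 by rewrite conjC0.
  by apply: (@nr_eq0 _ K[i]^o); apply/eqP; rewrite eq_le h nr_ge0.
have -> : nr (inner x v : K[i]^o) = rip v (u *: x) by rewrite ripC /rip ipZl hu.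
set z := u *: x.
have hz (t : K) : 0 < t -> 2 * rip v z <= t * nr z ^+ 2.
  move=> t0; have := hv (t%:C *: z).
  have Lz : L (t%:C *: z).
    by rewrite -[_ *: z]addr0; apply: (hL _ _ _) => //; rewrite -[z]addr0; apply: (hL _ _ _).
  move=> /(_ Lz); rewrite -(@ler_pXn2r _ 2) ?nnegrE ?nr_ge0 // nrsqB ripZr.
  by rewrite nrZr ?(ltW t0) // exprMn => h; rewrite -(ler_pM2l t0); nra.
rewrite leNgt; apply/negP => h.
have [z0|z0] := eqVneq (nr z) 0; first by have := hz _ ltr01; rewrite z0; nra.
have z2 : 0 < nr z ^+ 2 by rewrite exprn_gt0 // lt_neqAle eq_sym z0 nr_ge0.
have := hz _ (divr_gt0 h z2); rewrite divfK ?gt_eqF //; lra.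
Qed.

(** The parallelogram identity bounds the distance of two almost nearest points of
    [L] by the defect of minimality, so a minimizing sequence is Cauchy. *)
Lemma nearest_ex L x : lin_subspace L ->
  exists2 w, in_closure L w & forall l, L l -> nr (x - w) <= nr (x - l).
Proof.
move=> [L0 hL]; pose D := [set nr (x - l) | l in L].
have D_inf : has_inf D.
  by split; [exists (nr (x - 0)), 0|exists 0 => _ [l _ <-]; exact: nr_ge0].
pose d := inf D.
have hd l : L l -> d <= nr (x - l) by move=> Ll; apply: ge_inf; [case: D_inf|exists l].
have d0 : 0 <= d by apply: lb_le_inf; [case: D_inf|move=> _ [l _ <-]; exact: nr_ge0].
have /choice[u hu] : forall n : nat, exists l, L l /\ nr (x - l) < d + n.+1%:R^-1.
  move=> n; have [_ [l Ll <-] dl] : exists2 r, D r & r < d + n.+1%:R^-1.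
    by apply: inf_adherent => //; rewrite invr_gt0.
  by exists l.
have half l m : L l -> L m -> nr (l - m) ^+ 2 <=
    2 * nr (x - l) ^+ 2 + 2 * nr (x - m) ^+ 2 - 4 * d ^+ 2.
  move=> Ll Lm; pose h := (2^-1 : K)%:C *: l + ((2^-1 : K)%:C *: m + 0).
  have Lh : L h by do 2!apply: (hL _ _ _) => //.
  have eh : x - h = (2^-1 : K)%:C *: ((x - l) + (x - m)).
    rewrite /h addr0 scalerDr !scalerBr addrACA -opprD -scalerDl -rmorphD /=.
    by rewrite -[X in (X + X)]mul1r -splitr scale1r.
  have dh : d ^+ 2 <= 4^-1 * nr ((x - l) + (x - m)) ^+ 2.
    rewrite [leRHS](_ : _ = nr (x - h) ^+ 2).
      by rewrite ler_pXn2r ?nnegrE ?nr_ge0 ?hd.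
    by rewrite eh nrZr ?invr_ge0 // exprMn; congr (_ * _); field.
  have -> : l - m = (x - m) - (x - l) by rewrite opprB [RHS]addrC addrA subrK.
  rewrite nrsqD in dh; rewrite nrsqB ripC; lra.
have ucauchy : cauchy_nr u.
  move=> e e0.
  (* two points within [d + t] of [x], [t <= 1], are at squared distance at most
     [4 ((d + t) ^ 2 - d ^ 2) <= t (8 d + 4)] *)
  pose g := 8 * d + 4; have g0 : 0 < g by rewrite /g; lra.
  have [N hN] := nat_inv_lt (divr_gt0 (exprn_gt0 2 e0) g0).
  exists N => m n /andP[Nn nm].
  rewrite -(@ltr_pXn2r _ 2) ?nnegrE ?nr_ge0 ?(ltW e0) //.
  have [Lm um] := hu m; have [Ln un] := hu n.
  apply: (le_lt_trans (half _ _ Lm Ln)).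
  set t := N.+1%:R^-1 in hN.
  have t0 : 0 < t by rewrite invr_gt0.
  have t1 : t <= 1 by rewrite invf_le1 ?ler1n.
  have tle k : (N <= k)%N -> k.+1%:R^-1 <= t.
    by move=> Nk; rewrite lef_pV2 ?posrE ?ltr0n // ler_nat ltnS.
  have sq k : (N <= k)%N -> nr (x - u k) ^+ 2 <= (d + t) ^+ 2.
    move=> Nk; rewrite ler_pXn2r ?nnegrE ?nr_ge0 ?addr_ge0 ?(ltW t0) //.
    by rewrite (le_trans (ltW (hu k).2)) // lerD2l tle.
  have := sq _ Nn; have := sq _ (leq_trans Nn nm) => sm sn.
  apply: (@le_lt_trans _ _ (t * g)); last by rewrite -ltr_pdivlMr.
  have tt : t * t <= t by rewrite ger_pMl.
  have dt : (d + t) ^+ 2 = d ^+ 2 + 2 * (d * t) + t * t by ring.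
  have -> : t * g = 8 * (d * t) + 4 * t by rewrite /g; ring.
  rewrite dt in sm sn; lra.
have [w hw] := cauchy_lim ucauchy; exists w.
  move=> e /hw[N hN]; exists (u N); first by have [] := hu N.
  by rewrite nr_distC hN.
move=> l /hd dl; apply: le_trans dl; apply/ler_addgt0Pr => e e0.
have e2 := divr_gt0 e0 (ltr0n K 2).
have [N hN] := hw _ e2.
have [M hM] := nat_inv_lt e2.
pose n := maxn N M.
have -> : x - w = (x - u n) + (u n - w) by rewrite addrA subrK.
apply: (le_trans (nrD _ _)).
have h1 : nr (u n - w) < e / 2 by rewrite hN // leq_maxl.
have h2 : n.+1%:R^-1 < e / 2.
  by apply: le_lt_trans hM; rewrite lef_pV2 ?posrE ?ltr0n // ler_nat ltnS leq_maxr.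
have [_ h3] := hu n; move: (_^-1) h2 h3 => s h2 h3; lra.
Qed.

(** [p] is the orthogonal projection onto the closure of [L]. *)
Definition projector_on L (p : bounded_map H H) :=
  (forall x, in_closure L (p x)) /\ (forall x l, L l -> inner (x - p x) l = 0).

Lemma projector_uniq L x w w' : lin_subspace L ->
  in_closure L w -> (forall l, L l -> inner (x - w) l = 0) ->
  in_closure L w' -> (forall l, L l -> inner (x - w') l = 0) -> w = w'.
Proof.
move=> sL cw ow cw' ow'; apply/eqP; rewrite -subr_eq0; apply/eqP/ip_ext0.
have [_ /(_ (-1) _ _ cw' cw)] := subspace_closure sL.
rewrite scaleN1r addrC => /orth_closure; apply=> l Ll.
have -> : w - w' = (x - w') - (x - w) by rewrite opprB [RHS]addrC addrA subrK.
by rewrite ipC ipBl ow // ow' // subrr conjC0.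
Qed.

Lemma proj_pt L x : lin_subspace L ->
  exists2 w, in_closure L w & forall l, L l -> inner (x - w) l = 0.
Proof.
move=> sL; have [w cw hw] := nearest_ex x sL; exists w => // l Ll.
apply: (nearest_orth sL) Ll => m Lm.
rewrite -addrA -opprD; apply/ler_addgt0Pr => e /cw[k Lk wk].
rewrite (le_trans (hw (k + m) _)) //.
  by case: sL => _ /(_ 1 _ _ Lk Lm); rewrite scale1r.
have -> : x - (k + m) = (x - (w + m)) + (w - k).
  by rewrite !opprD !addrA (addrAC (x - w)) subrK addrAC.
by rewrite (le_trans (nrD _ _)) // lerD2l ltW.
Qed.

Lemma projector_ex L : lin_subspace L -> exists p, projector_on L p.
Proof.
move=> sL; have /choice[f hf] : forall x, exists w, in_closure L w /\
    forall l, L l -> inner (x - w) l = 0.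
  by move=> x; have [w] := proj_pt x sL; exists w.
have lf : linear f.
  move=> c x y; have [c1 o1] := hf x; have [c2 o2] := hf y.
  have [c3 o3] := hf (c *: x + y).
  apply: (projector_uniq sL c3 o3) => [|l Ll].
    by apply: (subspace_closure sL).2.
  rewrite opprD addrACA -scalerBr.
  by rewrite ipDl ipZl o1 // o2 // mulr0 addr0.
have bf x : nr (f x) <= 1 * nr x.
  have [c1 o1] := hf x; rewrite mul1r; apply: nrsq_le; first exact: nr_ge0.
  rewrite -[in leRHS](subrK (f x) x) nrsq_orth ?lerDr ?sqr_ge0 //.
  by rewrite ipC (orth_closure _ c1) ?conjC0 // => l Ll; rewrite ipC o1 ?conjC0.
by exists (mkbm lf bf); split => [x|x l Ll] /=; apply: (hf x).2 || apply: (hf x).1.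
Qed.

Lemma projector_id L p x : lin_subspace L -> projector_on L p ->
  in_closure L x -> p x = x.
Proof.
move=> sL [h1 h2] cx; apply: (projector_uniq sL (h1 x) (h2 x) cx) => l Ll.
by rewrite subrr ip0l.
Qed.

Lemma projector_projection L p : lin_subspace L -> projector_on L p -> projection p.
Proof.
move=> sL hp; have [h1 h2] := hp.
have o x y : inner (p x) (y - p y) = 0.
  by apply: (orth_closure _ (h1 x)) => l Ll; rewrite ipC h2 // conjC0.
split=> [x|x y]; first exact: (projector_id sL).
have := o x y; rewrite ipBr => /eqP; rewrite subr_eq0 => /eqP ->.
have := o y x; rewrite ipC ipBl => /(congr1 (@Num.conj K[i])); rewrite conjCK conjC0.
by move=> /eqP; rewrite subr_eq0 => /eqP.
Qed.

Lemma projection_comp p : projection p -> projection (bid - p).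
Proof.
move=> [h1 h2]; split=> [x|x y]; rewrite !bmB !bidE.
  by rewrite (raddfB p) /= h1 subrr subr0.
by rewrite ipBl ipBr h2.
Qed.

Lemma projection_orth p x y : projection p -> inner (p x) (y - p y) = 0.
Proof. by move=> [h1 h2]; rewrite ipBr -(h2 (p x)) h1 subrr. Qed.

Lemma projection_pyth p x : projection p ->
  nr x ^+ 2 = nr (p x) ^+ 2 + nr (x - p x) ^+ 2.
Proof.
by move=> hp; rewrite -nrsq_orth ?projection_orth // [_ + (_ - _)]addrC subrK.
Qed.

Lemma projection_nr p x : projection p -> nr (p x) <= nr x.
Proof.
move=> hp; apply: nrsq_le; first exact: nr_ge0.
by rewrite (projection_pyth x hp) lerDl sqr_ge0.
Qed.

Lemma projection_ip p x : projection p -> inner (p x) x = (nr (p x) ^+ 2)%:C.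
Proof. by move=> [h1 h2]; rewrite -{1}h1 h2 ipxx. Qed.

End OrthogonalProjection.

(** * Riesz representation and adjoints *)

Section Riesz.
Variables (K : realType) (H : hilbertType K).
Implicit Types (x y z : H).

(** A vector [v] orthogonal to the kernel of [phi] represents [phi] up to a scalar,
    because [phi v *: x - phi x *: v] lies in the kernel for every [x]. *)
Theorem riesz (phi : H -> K[i]) (C : K) :
  (forall (c : K[i]) x y, phi (c *: x + y) = c * phi x + phi y) ->
  (forall x, nr (phi x : K[i]^o) <= C * nr x) ->
  exists z, forall x, phi x = inner x z.
Proof.
move=> lphi bphi; pose L := [set x | phi x = 0].
have phi0 : phi 0 = 0.
  by apply: (@nr_eq0 _ K[i]^o); apply/eqP; rewrite eq_le nr_ge0 (le_trans (bphi 0)) ?nr0 ?mulr0.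
have sL : lin_subspace L.
  by split=> // c x y; rewrite /L /= lphi => -> ->; rewrite mulr0 addr0.
have phiB x y : phi (x - y) = phi x - phi y.
  by rewrite addrC -scaleN1r lphi mulN1r addrC.
have clL x : in_closure L x -> phi x = 0.
  move=> cx; apply: (@nr_small _ K[i]^o _ `|C|) => e /cx[l Ll xl].
  have -> : phi x = phi (x - l) by rewrite phiB [phi l]Ll subr0.
  rewrite (le_trans (bphi _)) // (@le_trans _ _ (`|C| * nr (x - l))) //.
    by rewrite ler_wpM2r ?nr_ge0 ?ler_norm.
  by rewrite ler_wpM2l ?normr_ge0 ?(ltW xl).
have [p [hp1 hp2]] := projector_ex sL.
have [h|/existsNP[x0 h]] := pselect (forall x, p x = x).
  by exists 0 => x; rewrite ip0r clL // -(h x).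
pose v := x0 - p x0.
have v0 : v != 0 by rewrite subr_eq0; apply/eqP => h'; apply: h.
have nv : inner v v != 0 by apply: contra_neq v0 => /ip_ext0.
exists ((((phi v)^*)%R / inner v v) *: v) => x.
have Lv : L (phi v *: x - phi x *: v).
  by rewrite /L /= phiB -[_ *: x]addr0 -[_ *: v]addr0 !lphi phi0 !addr0 mulrC subrr.
have := hp2 x0 _ Lv; rewrite -/v ipC ipBl !ipZl => /(congr1 (@Num.conj K[i])).
rewrite conjCK conjC0 => /eqP; rewrite subr_eq0 => /eqP E.
rewrite ipZr rmorphM /= conjCK fmorphV /= -ipC mulrAC E mulfK //.
Qed.

(** Riesz representation of [y |-> (B x y)^*] for each fixed [x]; linearity in [x]
    follows from uniqueness of the representing vector. *)
Theorem sesquilinear_repr (B : H -> H -> K[i]) (C : K) : 0 <= C ->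
  (forall (c : K[i]) x y z, B (c *: x + y) z = c * B x z + B y z) ->
  (forall (c : K[i]) x y z, B z (c *: x + y) = (c^*)%R * B z x + B z y) ->
  (forall x y, nr (B x y : K[i]^o) <= C * nr x * nr y) ->
  exists b : bounded_map H H, forall x y, inner (b x) y = B x y.
Proof.
move=> C0 B1 B2 bB.
have /choice[f hf] : forall x, exists z, forall y, inner z y = B x y.
  move=> x; have [|y|z hz] := @riesz (fun y => ((B x y)^*)%R) (C * nr x).
  - by move=> c y z; rewrite B2 rmorphD rmorphM /= conjCK.
  - by rewrite nr_conj.
  by exists z => y; rewrite ipC -hz conjCK.
have lf : linear f.
  by move=> c x y; apply: ip_ext => z; rewrite ipDl ipZl !hf B1.
have bf x : nr (f x) <= C * nr x.
  have [->|fx0] := eqVneq (f x) 0; first by rewrite nr0 mulr_ge0 ?nr_ge0.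
  rewrite -(ler_pM2r (nr_gt0 fx0)) -expr2 -[leLHS]nr_real ?sqr_ge0 // -ipxx hf.
  exact: bB.
by exists (mkbm lf bf).
Qed.

Lemma adjoint_ex (a : bounded_map H H) : exists b, adjoint a b.
Proof.
have [||||b hb] := @sesquilinear_repr (fun y x => inner y (a x)) (nr a).
- exact: nr_ge0.
- by move=> c x y z; rewrite ipDl ipZl.
- by move=> c x y z; rewrite linearP ipDr ipZr.
- move=> x y; rewrite (le_trans (ip_le _ _)) // mulrAC mulrC.
  by rewrite ler_wpM2r ?nr_ge0 ?bm_nr.
by exists b => x y; rewrite ipC -hb -ipC.
Qed.

Lemma adjointC (a b : bounded_map H H) : adjoint a b -> adjoint b a.
Proof. by move=> h x y; rewrite ipC -h -ipC. Qed.

Lemma adjoint_nr (a b : bounded_map H H) : adjoint a b -> nr b <= nr a.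
Proof.
move=> h; apply: bm_le => [|x]; first exact: nr_ge0.
have [->|bx0] := eqVneq (b x) 0; first by rewrite nr0 mulr_ge0 ?nr_ge0.
rewrite -(ler_pM2r (nr_gt0 bx0)) -expr2 -ripxx /rip -(h (b x)).
rewrite (le_trans (Re_nr _)) // (le_trans (ip_le _ _)) // mulrAC.
by rewrite ler_wpM2r ?nr_ge0 ?bm_nr.
Qed.

End Riesz.

(** * Operations inside a von Neumann algebra *)

Section VonNeumannBasics.
Variables (K : realType) (H : hilbertType K) (M : vonNeumannAlgebra H).
Implicit Types (a b c p : bounded_map H H).

Lemma vn_commuteP a :
  vn_set M a <-> forall c, commutant (vn_set M) c -> forall x, a (c x) = c (a x).
Proof. by rewrite -{1}vn_bicommutant. Qed.

Lemma vn_comp a b : vn_set M a -> vn_set M b -> vn_set M (bcomp a b).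
Proof.
move=> /vn_commuteP ha /vn_commuteP hb; apply/vn_commuteP => c hc x.
by rewrite !bcompE hb // ha.
Qed.

Lemma vn_id : vn_set M bid.
Proof. by apply/vn_commuteP. Qed.

Lemma vn_lin (k : K[i]) a b : vn_set M a -> vn_set M b -> vn_set M (k *: a + b).
Proof.
move=> /vn_commuteP ha /vn_commuteP hb; apply/vn_commuteP => c hc x.
by rewrite !bmD !bmZ ha // hb // linearP.
Qed.

Lemma vn_sub a b : vn_set M a -> vn_set M b -> vn_set M (a - b).
Proof. by move=> ha hb; rewrite addrC -scaleN1r; apply: vn_lin. Qed.

Lemma commutant_adjoint c d :
  adjoint c d -> commutant (vn_set M) c -> commutant (vn_set M) d.
Proof.
move=> cd hc a ha x; have [b hb ab] := vn_star ha.
have dc := adjointC cd.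
by apply: ip_ext => y; rewrite dc ab -hc // -dc ab.
Qed.

(** The commutant is self-adjoint, so a subspace that it leaves invariant
    reduces it, and the orthogonal projection lies in the bicommutant. *)
Lemma vn_projector (L : set H) p : lin_subspace L ->
  (forall c, commutant (vn_set M) c -> forall l, L l -> L (c l)) ->
  projector_on L p -> vn_set M p.
Proof.
move=> sL hL [hp1 hp2]; apply/vn_commuteP => c hc x.
have [d cd] := adjoint_ex c; have hd := commutant_adjoint cd hc.
apply: (projector_uniq sL (hp1 _) (hp2 _)) => [e e0|l Ll].
  have c1 : 0 < nr c + 1 by rewrite ltr_wpDl ?nr_ge0.
  have [l Ll pl] := hp1 x _ (divr_gt0 e0 c1).
  exists (c l); first exact: hL.
  rewrite -raddfB (le_lt_trans (bm_nr _ _)) //.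
  rewrite (@le_lt_trans _ _ ((nr c + 1) * nr (p x - l))) //.
    by rewrite ler_wpM2r ?nr_ge0 ?lerDl.
  by rewrite mulrC -ltr_pdivlMr.
by rewrite -raddfB cd hp2 //; apply: hL.
Qed.

End VonNeumannBasics.

(** * Square roots and spectral projections *)

Section LimitAlgebra.
Variables (K : realType) (V : normedModType K[i]).
Implicit Types (u v : nat -> V) (l m : V).

Lemma lim_toD u v l m :
  lim_to u l -> lim_to v m -> lim_to (fun n => u n + v n) (l + m).
Proof. by move=> /lim_toP h /lim_toP h'; apply/lim_toP; apply: cvgD. Qed.

Lemma lim_toZ (c : K[i]) u l : lim_to u l -> lim_to (fun n => c *: u n) (c *: l).
Proof. by move=> /lim_toP h; apply/lim_toP; apply: cvgZl_tmp. Qed.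

Lemma lim_to_cst l : lim_to (fun=> l) l.
Proof. by move=> e e0; exists 0%N => n _; rewrite subrr nr0. Qed.

Lemma lim_toS u l : lim_to u l -> lim_to (fun n => u n.+1) l.
Proof. by move=> h e /h[N hN]; exists N => n Nn; rewrite hN // leqW. Qed.

Lemma lim_to_le u l (C : K) : (forall n, nr (u n) <= C) -> lim_to u l -> nr l <= C.
Proof.
move=> h hl; apply/ler_addgt0Pr => e /hl[N /(_ N (leqnn N)) hN].
have -> : l = u N - (u N - l) by rewrite opprB addrC subrK.
by rewrite (le_trans (nrB _ _)) // lerD // ltW.
Qed.

End LimitAlgebra.

Section SquareRoot.
Variables (K : realType) (H : hilbertType K) (x : bounded_map H H).
Hypotheses (x1 : nr x <= 1) (xx : adjoint x x).
Implicit Types (v w : H).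

(** The iteration [y |-> (x + y ^ 2) / 2] from 0, whose limit [r] satisfies
    [(1 - r) ^ 2 = 1 - x]. It gives square roots without functional calculus. *)
Fixpoint root_iter (n : nat) : bounded_map H H :=
  if n is m.+1 then
    (2^-1 : K)%:C *: (x + bcomp (root_iter m) (root_iter m))
  else 0.

(** The same iteration for the number [x = 1]; it increases and is bounded by 1. *)
Fixpoint root_bound (n : nat) : K :=
  if n is m.+1 then 2^-1 * (1 + root_bound m ^+ 2) else 0.

Local Notation y := root_iter.
Local Notation t := root_bound.

Lemma root_iterS n v : y n.+1 v = (2^-1 : K)%:C *: (x v + y n (y n v)).
Proof. by []. Qed.

Lemma root_boundS n : t n.+1 = 2^-1 * (1 + t n ^+ 2).
Proof. by []. Qed.

Lemma root_bound01 n : 0 <= t n <= 1.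
Proof.
elim: n => [|n /andP[h1 h2]] /=; first by rewrite lexx ler01.
have := sqr_ge0 (t n); have : t n ^+ 2 <= 1 by rewrite expr_le1.
move: (t n ^+ 2) => s *; apply/andP; split; lra.
Qed.

Lemma root_bound_le n : t n <= t n.+1.
Proof. by have := sqr_ge0 (1 - t n) => /=; lra. Qed.

Lemma root_bound_mono n m : (n <= m)%N -> t n <= t m.
Proof.
elim: m => [|m IH]; first by rewrite leqn0 => /eqP ->.
by rewrite leq_eqVlt => /predU1P[->//|/IH h]; exact: le_trans (root_bound_le m).
Qed.

Lemma root_bound_cauchy (e : K) : 0 < e ->
  exists N, forall m n, (N <= n <= m)%N -> t m - t n < e.
Proof.
move=> e0; have hs : has_sup (range t).
  by split; [exists (t 0%N), 0%N|exists 1 => _ [n _ <-]; case/andP: (root_bound01 n)].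
have [_ [N _ <-] hN] := sup_adherent e0 hs.
exists N => m n /andP[Nn nm].
have : t m <= sup (range t) by apply: ub_le_sup; [case: hs|exists m].
have := root_bound_mono Nn; lra.
Qed.

Lemma nr_half : nr ((2^-1 : K)%:C : K[i]^o) = 2^-1.
Proof. by rewrite nr_real // invr_ge0. Qed.

Lemma root_iter_nr n v : nr (y n v) <= t n * nr v.
Proof.
elim: n v => [|n IH] v; first by rewrite bm0 nr0 mul0r.
rewrite root_iterS nrZ nr_half /= -mulrA ler_pM2l ?invr_gt0 //.
rewrite (le_trans (nrD _ _)) // mulrDl lerD //.
  by rewrite (le_trans (bm_nr _ _)) // ler_wpM2r ?nr_ge0.
rewrite (le_trans (IH _)) // expr2 -mulrA ler_wpM2l //.
by case/andP: (root_bound01 n).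
Qed.

Lemma root_iter_nr1 n v : nr (y n v) <= nr v.
Proof.
rewrite (le_trans (root_iter_nr _ _)) // ler_piMl ?nr_ge0 //.
by case/andP: (root_bound01 n).
Qed.

Lemma root_iter_comm (g : bounded_map H H) : (forall v, g (x v) = x (g v)) ->
  forall n v, g (y n v) = y n (g v).
Proof.
move=> hg; elim=> [|n IH] v; first by rewrite !bm0 raddf0.
by rewrite !root_iterS linearZ linearD /= hg !IH.
Qed.

Lemma root_iterC m n v : y m (y n v) = y n (y m v).
Proof.
apply: root_iter_comm => w; apply/esym; apply: (root_iter_comm (g := x)) => //.
Qed.

(** The iterates commute, so
    [2 (y_(n+2) - y_(n+1)) = (y_(n+1) + y_n) (y_(n+1) - y_n)], and the scalar
    sequence satisfies the same recursion: operator increments are dominated by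
    the scalar increments, whose sum converges. *)
Lemma root_iter_step n v : nr (y n.+1 v - y n v) <= (t n.+1 - t n) * nr v.
Proof.
elim: n v => [|n IH] v.
  by rewrite bm0 !subr0; apply: root_iter_nr.
have -> : y n.+2 v - y n.+1 v = (2^-1 : K)%:C *:
    (y n.+1 (y n.+1 v - y n v) + y n (y n.+1 v - y n v)).
  rewrite (root_iterS n.+1) (root_iterS n v) -scalerBr; congr (_ *: _).
  rewrite opprD addrACA subrr add0r !bm_subr.
  by rewrite (root_iterC n.+1 n) addrA subrK.
rewrite nrZ nr_half.
have -> : t n.+2 - t n.+1 = 2^-1 * ((t n.+1 + t n) * (t n.+1 - t n)).
  rewrite (root_boundS n.+1) {2}(root_boundS n); ring.
rewrite -mulrA ler_pM2l ?invr_gt0 // (le_trans (nrD _ _)) //.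
rewrite -mulrA mulrDl lerD // (le_trans (root_iter_nr _ _)) // ler_wpM2l //.
  by case/andP: (root_bound01 n.+1).
by case/andP: (root_bound01 n).
Qed.

Lemma root_iter_dist n m v : (n <= m)%N ->
  nr (y m v - y n v) <= (t m - t n) * nr v.
Proof.
elim: m => [|m IH]; first by rewrite leqn0 => /eqP ->; rewrite !subrr nr0 mul0r.
rewrite leq_eqVlt => /predU1P[->|/IH h]; first by rewrite !subrr nr0 mul0r.
have -> : y m.+1 v - y n v = (y m.+1 v - y m v) + (y m v - y n v).
  by rewrite addrA subrK.
rewrite (le_trans (nrD _ _)) //; have := root_iter_step m v; lra.
Qed.

Lemma root_iter_lim v : exists l, lim_to (fun n => y n v) l.
Proof.
apply: cauchy_lim => e e0; have v1 : 0 < nr v + 1 by rewrite ltr_wpDl ?nr_ge0.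
have [N hN] := root_bound_cauchy (divr_gt0 e0 v1); exists N => m n Nnm.
have /andP[_ nm] := Nnm; rewrite (le_lt_trans (root_iter_dist v nm)) //.
rewrite (@le_lt_trans _ _ ((t m - t n) * (nr v + 1))) //.
  by rewrite ler_wpM2l ?lerDl // subr_ge0 root_bound_mono.
by rewrite -ltr_pdivlMr // hN.
Qed.

(** The bound on increments is uniform, so the iterates converge pointwise. All the
    algebraic properties of the iterates, including commutation with whatever
    commutes with [x], pass to the limit. *)
Lemma contraction_root : exists r : bounded_map H H,
  [/\ nr r <= 1, adjoint r r, forall v, r v + r v = x v + r (r v) &
      forall g : bounded_map H H, (forall v, g (x v) = x (g v)) ->
      forall v, g (r v) = r (g v)].
Proof.
have /choice[f hf] := root_iter_lim.
have lf : linear f.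
  move=> c v w; apply: (lim_to_uniq (hf _)).
  have := lim_toD (lim_toZ c (hf v)) (hf w).
  by under eq_fun do rewrite -linearP.
have bf v : nr (f v) <= 1 * nr v.
  by rewrite mul1r; apply: (lim_to_le _ (hf v)) => n; apply: root_iter_nr1.
exists (mkbm lf bf); split.
- by apply: bm_le => // v; apply: bf.
- have ya n : adjoint (y n) (y n).
    elim: n => [|n IH] v w; first by rewrite !bm0 ip0l ip0r.
    rewrite !root_iterS ipZl ipZr ipDl ipDr xx !IH; congr (_ * _).
    by rewrite conj_real.
  move=> v w; apply: (@lim_to_uniq _ K[i]^o _ _ _ (ip_lim w (hf v))).
  under eq_fun do rewrite ya; move=> e e0.
  have [N hN] := ip_lim v (hf w) e0.
  by exists N => n /hN; rewrite -[X in X < _]nr_conj rmorphB /= -!ipC.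
- move=> v; rewrite /=.
  have -> : f v + f v = (2%:R : K[i]) *: f v by rewrite scaler_nat mulr2n.
  have h : lim_to (fun n => y n (y n v)) (f (f v)).
    move=> e e0; have [N1 h1] := hf v _ (divr_gt0 e0 (ltr0n _ 2)).
    have [N2 h2] := hf (f v) _ (divr_gt0 e0 (ltr0n _ 2)).
    exists (maxn N1 N2) => n; rewrite geq_max => /andP[/h1 {}h1 /h2 {}h2].
    have -> : y n (y n v) - f (f v) =
        y n (y n v - f v) + (y n (f v) - f (f v)).
      by rewrite bm_subr addrA subrK.
    rewrite (le_lt_trans (nrD _ _)) // [ltRHS](splitr e) ltrD //.
    exact: le_lt_trans (root_iter_nr1 _ _) h1.
  have h' := lim_toZ 2%:R (lim_toS (hf v)).
  apply: (lim_to_uniq h').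
  have := lim_toD (lim_to_cst (x v)) h.
  suff E : (fun n => 2%:R *: y n.+1 v) = (fun n => x v + y n (y n v)) by rewrite E.
  apply/funext => n; rewrite root_iterS scalerA.
  by rewrite fmorphV rmorph_nat mulfV ?scale1r // pnatr_eq0.
- move=> g hg v; apply: (lim_to_uniq (bm_lim g (hf v))).
  by under eq_fun do rewrite root_iter_comm //; apply: hf.
Qed.

End SquareRoot.

Section SpectralSubspace.
Variables (K : realType) (H : hilbertType K) (M : vonNeumannAlgebra H).
Implicit Types (a b c p : bounded_map H H).

(** The operator [d] is the modulus of [c], the positive square root
    [1 - r] of [c ^ 2 = 1 - x] with [x = 1 - c ^ 2]. *)
Lemma modulus_ex c : adjoint c c -> nr c <= 1 -> exists d : bounded_map H H,
  [/\ forall v, 0 <= rip (d v) v, forall v, d (d v) = c (c v) &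
      forall g : bounded_map H H, (forall v, g (c v) = c (g v)) ->
      forall v, g (d v) = d (g v)].
Proof.
move=> cc c1; pose x := bid - bcomp c c.
have xE v : x v = v - c (c v) by [].
have cle v : nr (c v) <= nr v.
  by rewrite (le_trans (bm_nr _ _)) // ler_piMl ?nr_ge0.
have xx : adjoint x x by move=> v w; rewrite !xE ipBl ipBr cc cc.
have x1 : nr x <= 1.
  apply: bm_le => // v; rewrite mul1r; apply: nrsq_le; first exact: nr_ge0.
  have rcc : rip v (c (c v)) = nr (c v) ^+ 2 by rewrite -ripxx /rip cc.
  rewrite xE nrsqB rcc.
  have : nr (c (c v)) ^+ 2 <= nr (c v) ^+ 2 by rewrite ler_pXn2r ?nnegrE ?nr_ge0.
  have := sqr_ge0 (nr (c v)); lra.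
have [r [r1 rr rE rC]] := contraction_root x1 xx.
have dE v : (bid - r) v = v - r v by [].
exists (bid - r); split=> [v|v|g hg v]; rewrite !dE.
- rewrite ripBl ripxx subr_ge0 (le_trans (rip_le _ _)) // expr2.
  by rewrite ler_wpM2r ?nr_ge0 // (le_trans (bm_nr _ _)) // ler_piMl ?nr_ge0.
- rewrite bm_subr opprB addrACA -opprD.
  by rewrite rE opprD addrACA subrr addr0 xE opprB addrC subrK.
by rewrite bm_subr rC // => w; rewrite !xE bm_subr !hg.
Qed.

(** Take [c = (b^* b - lam) / 2] and its modulus [d]. On the kernel of [d - c] one has
    [c = d >= 0]. This kernel is invariant under the commutant, so its projection
    is in the algebra. It contains the range of [d + c], because [d ^ 2 = c ^ 2]
    and [d], [c] commute. If it were zero, then [c = - d <= 0], so [b^* b <= lam],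
    which contradicts [nr b = 1]. *)
Lemma spectral_projection b (lam : K) : vn_set M b -> nr b = 1 ->
  0 <= lam < 1 -> exists e, [/\ vn_set M e, projection e, e != 0 &
    forall v, lam * nr (e v) ^+ 2 <= nr (b (e v)) ^+ 2].
Proof.
move=> Mb b1 /andP[l0 l1]; have [b' Mb' bb'] := vn_star Mb.
have b'b := adjointC bb'.
(* the factor 1/2 makes [c] a contraction *)
pose c : bounded_map H H := (2^-1 : K)%:C *: (bcomp b' b - lam%:C *: bid).
have cE v : c v = (2^-1 : K)%:C *: (b' (b v) - lam%:C *: v) by [].
have Mc : vn_set M c.
  rewrite -[c]addr0; apply: vn_lin; last by rewrite -(subrr b); apply: vn_sub.
  rewrite addrC -scaleNr; apply: vn_lin; [exact: vn_id|exact: vn_comp].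
have cc : adjoint c c.
  move=> v w; rewrite !cE ipZl ipZr ipBl ipBr ipZl ipZr b'b bb'.
  by rewrite !conj_real.
have c1 : nr c <= 1.
  apply: bm_le => // v; rewrite mul1r cE nrZr ?invr_ge0 //.
  have h1 : nr (b v) <= nr v by rewrite (le_trans (bm_nr _ _)) // b1 mul1r.
  have h2 : nr (b' (b v)) <= nr v.
    rewrite (le_trans (bm_nr _ _)) // (le_trans _ h1) //.
    by rewrite ler_piMl ?nr_ge0 // -b1 adjoint_nr.
  have h3 := nrB (b' (b v)) (lam%:C *: v); rewrite nrZr // in h3.
  have := nr_ge0 v; nra.
have rc v : rip (c v) v = 2^-1 * (nr (b v) ^+ 2 - lam * nr v ^+ 2).
  by rewrite cE ripZl ripBl ripZl ripxx /rip b'b -/(rip _ _) ripxx.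
have [d [d0 dd dC]] := modulus_ex cc c1.
pose L := [set v | d v = c v].
have sL : lin_subspace L.
  split=> [|k v w hv hw]; first by change (d 0 = c 0); rewrite !bm_0r.
  by change (d (k *: v + w) = c (k *: v + w)); rewrite !bm_addr !bm_scaler hv hw.
have clL v : in_closure L v -> d v = c v.
  move=> cv; apply/eqP; rewrite -subr_eq0; apply/eqP.
  apply: (@nr_small _ _ _ (nr (d - c))) => e /cv[l Ll vl].
  have -> : d v - c v = (d - c) (v - l).
    by rewrite bm_subr !bmB [d l]Ll subrr subr0.
  by rewrite (le_trans (bm_nr _ _)) // ler_wpM2l ?nr_ge0 // ltW.
have [e he] := projector_ex sL.
have Me : vn_set M e.
  apply: (vn_projector sL _ he) => g hg l; rewrite /L /= => dl.
  have gc v : g (c v) = c (g v) by apply/esym; move/vn_commuteP: Mc; apply.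
  by rewrite -(dC g gc) dl gc.
have pe := projector_projection sL he.
exists e; split=> //; last first.
  move=> v; have := d0 (e v); rewrite clL ?rc; last exact: he.1.
  by rewrite pmulr_rge0 ?invr_gt0 // subr_ge0.
apply/eqP => e0.
have s1 : Num.sqrt lam < nr b by rewrite b1 -sqrtr1 ltr_sqrt.
have [v hv] := bm_attain (sqrtr_ge0 _) s1.
have Lv : L (d v + c v).
  by change (d (d v + c v) = c (d v + c v)); rewrite !bm_addr dd (dC c) // addrC.
have := projector_id sL he (in_closure_sub Lv); rewrite e0 bm0 => /esym/eqP.
rewrite addr_eq0 => /eqP dv; have := d0 v; rewrite dv.
have -> : rip (- c v) v = - rip (c v) v by rewrite -[- c v]sub0r ripBl /rip ip0l sub0r.
rewrite rc; move: hv; rewrite -(@ltr_pXn2r _ 2) ?nnegrE ?mulr_ge0 ?sqrtr_ge0 ?nr_ge0 //.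
by rewrite exprMn sqr_sqrtr //; lra.
Qed.

End SpectralSubspace.

(** * Small projections in an atomless algebra *)

Section SmallProjections.
Variables (K : realType) (H : hilbertType K) (M : vonNeumannAlgebra H).
Implicit Types (a b p q e : bounded_map H H).

(** [operator_le q p] makes the kernel of [p] part of the kernel of [q], which is
    [q p = q]; the other equation is its adjoint. *)
Lemma operator_le_sub q p : projection q -> projection p -> operator_le q p ->
  forall x, p (q x) = q x /\ q (p x) = q x.
Proof.
move=> pq pp qp.
have qp0 x : q (p x) = q x.
  apply/esym/eqP; rewrite -subr_eq0 -bm_subr; apply/eqP/nr_eq0/eqP.
  rewrite -sqrf_eq0 eq_le sqr_ge0 andbT -lecR -projection_ip //.
  rewrite (le_trans (qp _)) // bm_subr pp.1 subrr ip0l //.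
have [_ aq] := pq; have [_ ap] := pp.
move=> x; split=> //; apply: ip_ext => y.
by rewrite ap aq qp0 -aq.
Qed.

Lemma projection_sub p q : projection q -> projection p ->
  (forall x, p (q x) = q x /\ q (p x) = q x) -> projection (p - q).
Proof.
move=> [q1 q2] [p1 p2] h; split=> [x|x y]; rewrite !bmB.
  by rewrite !bm_subr p1 q1 (h x).1 (h x).2 subrr subr0.
by rewrite ipBl ipBr p2 q2.
Qed.

(** A nonzero projection is not minimal, so it splits into two orthogonal nonzero
    parts. The weight [p |-> sum of nr (p z) ^ 2] is additive on orthogonal parts,
    so one of them carries at most half of it. *)
Lemma halve_projection (s : seq H) e : atomless M ->
  vn_set M e -> projection e -> e != 0 ->
  exists p, [/\ vn_set M p, projection p, p != 0, forall x, e (p x) = p x &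
    \sum_(z <- s) nr (p z) ^+ 2 <= (\sum_(z <- s) nr (e z) ^+ 2) / 2].
Proof.
move=> aM Me pe e0.
have [q [Mq pq qe q0 qne]] : exists q, [/\ vn_set M q, projection q,
    operator_le q e, q != 0 & q != e].
  apply: contrapT => h; apply: (aM e); split=> // q Mq pq qe.
  have [->|q0] := eqVneq q 0; first by left.
  have [->|qne] := eqVneq q e; first by right.
  by case: h; exists q.
have eq := operator_le_sub pq pe qe.
have pr := projection_sub pq pe eq.
have r0 : e - q != 0 by rewrite subr_eq0 eq_sym.
have split_sum : \sum_(z <- s) nr (e z) ^+ 2 =
    \sum_(z <- s) nr (q z) ^+ 2 + \sum_(z <- s) nr ((e - q) z) ^+ 2.
  rewrite -big_split; apply: eq_bigr => z _ /=.
  rewrite -nrsq_orth ?bmB ?[q z + _]addrC ?subrK //.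
  by rewrite ipBr -(pq.2 (q z)) pq.1 -(pe.2 (q z)) (eq z).1 subrr.
have [h|h] := leP (\sum_(z <- s) nr (q z) ^+ 2) ((\sum_(z <- s) nr (e z) ^+ 2) / 2).
  by exists q; split=> // x; rewrite (eq x).1.
exists (e - q); split=> //; first exact: vn_sub.
  by move=> x; rewrite !bmB bm_subr pe.1 (eq x).1.
by move: h; rewrite split_sum; lra.
Qed.

Lemma small_projection (s : seq H) e (d : K) : atomless M ->
  vn_set M e -> projection e -> e != 0 -> 0 < d ->
  exists p, [/\ vn_set M p, projection p, p != 0, forall x, e (p x) = p x &
    forall z, z \in s -> nr (p z) < d].
Proof.
move=> aM Me pe e0 d0; pose W p := \sum_(z <- s) nr (p z) ^+ 2.
have W0 p : 0 <= W p by apply: sumr_ge0 => z _; rewrite sqr_ge0.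
have iter n : exists p, [/\ vn_set M p, projection p, p != 0,
    forall x, e (p x) = p x & n.+1%:R * W p <= W e].
  elim: n => [|n [p [Mp pp p0 ep hW]]].
    by exists e; split=> // [x|]; rewrite ?pe.1 ?mul1r.
  have [p' [Mp' pp' p'0 pp'E hW']] := halve_projection s aM Mp pp p0.
  exists p'; split=> // [x|]; first by rewrite -pp'E ep.
  apply: le_trans hW; rewrite -/(W p) -/(W p') in hW'.
  have n1 : (1 : K) <= n.+1%:R by rewrite ler1n.
  rewrite -natr1; have := W0 p'; move: (W p') (W p) hW' (n.+1%:R) n1 => x y xy N N1 x0.
  have : N * (2 * x) <= N * y by rewrite ler_pM2l; lra.
  nra.
have We1 : 0 < W e + 1 by rewrite ltr_wpDl.
have [n hn] := nat_inv_lt (divr_gt0 (exprn_gt0 2 d0) We1).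
have [p [Mp pp p0 ep hW]] := iter n; exists p; split=> // z zs.
rewrite -(@ltr_pXn2r _ 2) ?nnegrE ?nr_ge0 ?(ltW d0) //.
have le1 : nr (p z) ^+ 2 <= W p.
  rewrite /W (big_rem z) //= lerDl; apply: sumr_ge0 => w _.
  by rewrite sqr_ge0.
apply: (le_lt_trans le1); have N0 : (0 : K) < n.+1%:R by rewrite ltr0n.
rewrite -(ltr_pM2l N0) (le_lt_trans hW) //.
move: hn; rewrite ltr_pdivlMr // mulrC ltr_pdivrMr // mulrC.
by apply: le_lt_trans; rewrite lerDl.
Qed.

(** [q] is the range projection of [b p]. For [l = b (p v)] one has
    [inner l y = inner (p v) (p (b^* y))], and [nr (p v)] is at most
    [nr l / sqrt lam] since [b] is bounded below on the range of [p]. Hence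
    smallness of [p] on [b^* y] makes [q] small on [y], although [q] and [p] need
    not be comparable. *)
Lemma left_support b b' p (lam : K) :
  vn_set M b -> vn_set M p -> adjoint b b' -> projection p -> 0 < lam ->
  (forall v, lam * nr (p v) ^+ 2 <= nr (b (p v)) ^+ 2) ->
  exists q, [/\ vn_set M q, projection q, forall v, q (b (p v)) = b (p v) &
    forall y, Num.sqrt lam * nr (q y) <= nr (p (b' y))].
Proof.
move=> Mb Mp bb' pp l0 hb; pose L := [set w | exists v, w = b (p v)].
have sL : lin_subspace L.
  split=> [|c _ _ [v ->] [w ->]]; first by exists 0; rewrite !bm_0r.
  by exists (c *: v + w); rewrite !bm_addr !bm_scaler.
have [q hq] := projector_ex sL; exists q.
have pq := projector_projection sL hq.
split=> //.
- apply: (vn_projector sL _ hq) => c hc _ [v ->]; exists (c v).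
  by move: Mb Mp => /vn_commuteP Mb /vn_commuteP Mp; rewrite (Mp _ hc) (Mb _ hc).
- by move=> v; apply: (projector_id sL hq); apply: in_closure_sub; exists v.
move=> y; set s := Num.sqrt lam; have s0 : 0 < s by rewrite sqrtr_gt0.
set r := nr (p (b' y)); have r0 : 0 <= r := nr_ge0 _.
have onL l : L l -> s * rip l y <= r * nr l.
  move=> [v ->]; have -> : rip (b (p v)) y = rip (p v) (p (b' y)).
    by rewrite /rip bb' -pp.2 pp.1.
  have h : s * nr (p v) <= nr (b (p v)).
    apply: nrsq_le; first exact: nr_ge0.
    by rewrite exprMn sqr_sqrtr ?hb ?ltW.
  rewrite (@le_trans _ _ (s * (nr (p v) * r))) ?ler_pM2l ?rip_le //.
  by rewrite mulrA mulrC ler_wpM2l.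
have onC w : in_closure L w -> s * rip w y <= r * nr w.
  move=> cw; apply/ler_addgt0Pr => e e0.
  pose D := s * nr y + r + 1.
  have D0 : 0 < D by rewrite /D ltr_wpDl // addr_ge0 // mulr_ge0 ?nr_ge0 ?ltW.
  have [l Ll wl] := cw _ (divr_gt0 e0 D0).
  have -> : rip w y = rip l y + rip (w - l) y by rewrite -ripDl addrC subrK.
  have h1 := rip_le (w - l) y.
  have h2 : nr l <= nr w + nr (w - l).
    rewrite {1}(_ : l = w - (w - l)); last by rewrite opprB addrC subrK.
    exact: nrB.
  rewrite ltr_pdivlMr // in wl.
  have h3 := onL _ Ll; have n0 := nr_ge0 (w - l).
  have h4 : s * rip (w - l) y <= s * (nr (w - l) * nr y) by rewrite ler_pM2l.
  have h5 : r * nr l <= r * (nr w + nr (w - l)) by rewrite ler_wpM2l.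
  rewrite /D in wl; lra.
have := onC _ (hq.1 y).
have [->|qy0] := eqVneq (nr (q y)) 0; first by move=> _; rewrite mulr0.
have qy : 0 < nr (q y) by rewrite lt_neqAle eq_sym qy0 nr_ge0.
by rewrite {1}/rip projection_ip //= expr2 mulrA ler_pM2r.
Qed.

End SmallProjections.

(** * Linear forms and the sigma-weak coordinates *)

Section LinearForms.
Variables (F : fieldType) (V : lmodType F).
Implicit Types (f g : V -> F) (s : seq (V -> F)).

Definition linear_form f := forall (c : F) u v, f (c *: u + v) = c * f u + f v.

Lemma linear_form0 f : linear_form f -> f 0 = 0.
Proof. by move=> /(_ (-1) 0 0); rewrite scaler0 addr0 mulN1r addNr. Qed.

Lemma linear_formB f u v : linear_form f -> f (u - v) = f u - f v.
Proof. by move=> hf; rewrite addrC -scaleN1r hf mulN1r addrC. Qed.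

Lemma linear_formZ f c u : linear_form f -> f (c *: u) = c * f u.
Proof. by move=> hf; rewrite -[c *: u]addr0 hf (linear_form0 hf) addr0. Qed.

(** Induction on [s]: either the common kernel of the tail is contained in
    that of [phi i], or some [v0] in it has [phi i v0 != 0] and the tail already
    handles [z - (z v0 / phi i v0) phi i]. *)
Lemma span_of_kernel (I : Type) (phi : I -> V -> F) (s : seq I) (z : V -> F) :
  (forall i, linear_form (phi i)) -> linear_form z ->
  (forall v, (forall i, List.In i s -> phi i v = 0) -> z v = 0) ->
  exists c : seq (F * I), forall v, z v = \sum_(i <- c) i.1 * phi i.2 v.
Proof.
move=> lphi; elim: s z => [|i s IH] z lz hz.
  by exists [::] => v; rewrite big_nil; apply: hz.
have [[v0 [hv0 pv0]]|h] := pselect (exists v, (forall j, List.In j s -> phi j v = 0) /\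
    phi i v <> 0).
  have p0 : phi i v0 != 0 by apply/eqP.
  pose c := z v0 / phi i v0.
  have [||t ht] := IH (fun v => z v - c * phi i v).
  - by move=> k u v; rewrite lz lphi; ring.
  - move=> v hv; pose w := v - (phi i v / phi i v0) *: v0.
    have : z w = 0.
      apply: hz => j [<-|js].
        by rewrite linear_formB // linear_formZ // divfK // subrr.
      by rewrite linear_formB // linear_formZ // (hv j) // (hv0 j) // mulr0 subrr.
    rewrite linear_formB // linear_formZ // => <-; rewrite /c; congr (_ - _).
    by rewrite mulrAC [RHS]mulrAC; congr (_ / _); rewrite mulrC.
  by exists ((c, i) :: t) => v; rewrite big_cons -ht /= addrC subrK.
apply: IH => // v hv; apply: hz => j [<-|/hv//].
by apply: contrapT => hj; apply: h; exists v.
Qed.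

End LinearForms.

Section SquareSummable.
Variables (K : realType) (H : hilbertType K).
Implicit Types (xi eta : nat -> H).

Definition l2_tail xi := forall e : K, 0 < e -> exists N, forall m n,
  (N <= n <= m)%N -> \sum_(n <= i < m) nr (xi i) ^+ 2 < e.

Let sq xi : nat -> K[i]^o := series (fun n => `|xi n| ^+ 2).

Let sq_tail xi m n : (n <= m)%N ->
  sq xi m - sq xi n = (\sum_(n <= i < m) nr (xi i) ^+ 2)%:C.
Proof.
move=> nm; rewrite /sq sub_series_geq // rmorph_sum /=.
by apply: eq_bigr => i _; rewrite rmorphXn /= nrE.
Qed.

Lemma l2_tailP xi :
  l2_tail xi <-> cvgn (series (fun n => `|xi n| ^+ 2) : nat -> K[i]^o).
Proof.
split=> [h|h].
  suff /cauchy_limC[l /lim_toP hl] : cauchy_nr (sq xi) by apply: (cvgP l hl).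
  move=> e /h[N hN]; exists N => m n Nnm; have /andP[_ nm] := Nnm.
  rewrite sq_tail // nr_real ?hN //.
  by apply: sumr_ge0 => i _; rewrite sqr_ge0.
have /lim_toP/lim_to_cauchy hc := h.
move=> e /hc[N hN]; exists N => m n Nnm; have /andP[_ nm] := Nnm.
have := hN m n Nnm; rewrite [X in nr X]sq_tail // nr_real //.
by apply: sumr_ge0 => i _; rewrite sqr_ge0.
Qed.

Lemma l2_tail_map (b : bounded_map H H) xi :
  l2_tail xi -> l2_tail (fun n => b (xi n)).
Proof.
move=> h e e0; have b1 : 0 < nr b ^+ 2 + 1 by rewrite ltr_wpDl ?sqr_ge0.
have [N hN] := h _ (divr_gt0 e0 b1); exists N => m n /hN.
rewrite ltr_pdivlMr // mulrC; apply: le_lt_trans.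
rewrite mulr_sumr; apply: ler_sum => i _.
rewrite (@le_trans _ _ ((nr b * nr (xi i)) ^+ 2)) //.
  by rewrite ler_pXn2r ?nnegrE ?mulr_ge0 ?nr_ge0 ?bm_nr.
by rewrite exprMn ler_wpM2r ?sqr_ge0 ?lerDl.
Qed.

Definition l2_map (b : bounded_map H H) (x : l2seq H) : l2seq H :=
  @L2Seq _ _ (fun n => b (x n))
    ((l2_tailP _).1 (l2_tail_map b ((l2_tailP _).2 (@l2seqP _ _ x)))).

Lemma l2_tail_single (x : H) : l2_tail (fun n => if n is 0 then x else 0).
Proof.
move=> e e0; exists 1%N => m n /andP[n0 nm].
rewrite big_nat big1 // => -[|i]; last by rewrite nr0 expr0n.
by rewrite leqNgt n0.
Qed.

Definition l2_single (x : H) : l2seq H :=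
  @L2Seq _ _ (fun n => if n is 0 then x else 0) ((l2_tailP _).1 (l2_tail_single x)).

End SquareSummable.

Section SigmaWeak.
Variables (K : realType) (H : hilbertType K) (M : vonNeumannAlgebra H).
Local Notation E := (vn_elt M).
Implicit Types (a : E) (pr : l2seq H * l2seq H).

Definition vnE (b : bounded_map H H) (Mb : vn_set M b) : E :=
  @NormedSubspace _ _ (vn_mem M) b (mem_set Mb).

Lemma vn_eltP a : vn_set M (subspace_val a).
Proof. exact/set_mem/normed_subspace_subproof. Qed.

Lemma vn_elt_nr a : nr a = nr (subspace_val a).
Proof. by []. Qed.

Lemma vn_eltE (k : K[i]) a b x :
  subspace_val (k *: a + b) x = k *: subspace_val a x + subspace_val b x.
Proof. by []. Qed.

Lemma vn_eltZ (k : K[i]) a x : subspace_val (k *: a) x = k *: subspace_val a x.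
Proof. by []. Qed.

Lemma vn_eltB (a b : E) x : subspace_val (a - b) x = subspace_val a x - subspace_val b x.
Proof. by []. Qed.

Lemma vn_elt_ext (a b : E) : (forall x, subspace_val a x = subspace_val b x) -> a = b.
Proof. by move=> h; apply: val_inj; apply: bm_ext. Qed.

Lemma vn_elt_le a (r : K) : 0 <= r ->
  (forall x, nr (subspace_val a x) <= r * nr x) -> nr a <= r.
Proof. by rewrite vn_elt_nr; apply: bm_le. Qed.

(** The coordinates of the sigma-weak evaluation map: the functionals
    [a |-> sum over n of inner (a (xi n)) (eta n)]. *)
Definition sw (pr : l2seq H * l2seq H) (a : E) : K[i]^o := @sigma_weak_eval K H M a pr.

Let partial pr a : nat -> K[i]^o :=
  series (fun n => inner (subspace_val a (pr.1 n)) (pr.2 n)).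

(** By [s t <= s ^ 2 + t ^ 2] the tail at [a] is at most [nr a] times the tails of
    the two square-summable sequences, uniformly in [a]. *)
Lemma sw_cauchy pr (e : K) : 0 < e -> exists N, forall a m n, (N <= n <= m)%N ->
  nr (partial pr a m - partial pr a n) <= e * nr a.
Proof.
move=> e0; have e2 := divr_gt0 e0 (ltr0n K 2).
have [N1 h1] := (l2_tailP _).2 (@l2seqP _ _ pr.1) _ e2.
have [N2 h2] := (l2_tailP _).2 (@l2seqP _ _ pr.2) _ e2.
exists (maxn N1 N2) => a m n; rewrite geq_max => /andP[/andP[n1 n2] nm].
have {}h1 := h1 m n; have {}h2 := h2 m n.
rewrite n1 n2 nm in h1 h2; have {}h1 := h1 erefl; have {}h2 := h2 erefl.
rewrite /partial sub_series_geq //.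
apply: (le_trans (nr_sum _ _)).
apply: (@le_trans _ _ (nr a *
  (\sum_(n <= i < m) nr (pr.1 i) ^+ 2 + \sum_(n <= i < m) nr (pr.2 i) ^+ 2))).
  rewrite -big_split mulr_sumr; apply: ler_sum => i _ /=.
  rewrite (le_trans (ip_le _ _)) //.
  have := bm_nr (subspace_val a) (pr.1 i).
  rewrite -vn_elt_nr => /(ler_wpM2r (nr_ge0 (pr.2 i)))/le_trans; apply.
  rewrite -mulrA ler_wpM2l ?nr_ge0 //.
  have := sqr_ge0 (nr (pr.1 i) - nr (pr.2 i)).
  have := sqr_ge0 (nr (pr.1 i)); have := sqr_ge0 (nr (pr.2 i)); nra.
by rewrite mulrC ler_wpM2r ?nr_ge0 // (splitr e) lerD // ltW.
Qed.

Lemma sw_lim pr a : lim_to (partial pr a) (sw pr a).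
Proof.
have /cauchy_limC[l hl] : cauchy_nr (partial pr a).
  move=> e e0; have a1 : 0 < nr a + 1 by rewrite ltr_wpDl ?nr_ge0.
  have [N hN] := sw_cauchy pr (divr_gt0 e0 a1); exists N => m n /(hN a) h.
  apply: (le_lt_trans h); rewrite mulrAC ltr_pdivrMr // ltr_pM2l //.
  by rewrite ltrDl.
by rewrite /sw /sigma_weak_eval (lim_to_lim hl).
Qed.

Lemma sw_linear pr : @linear_form _ E (sw pr).
Proof.
move=> k a b; apply: (lim_to_uniq (sw_lim pr _)).
have := lim_toD (lim_toZ k (sw_lim pr a)) (sw_lim pr b).
suff -> : (fun n => k *: partial pr a n + partial pr b n) = partial pr (k *: a + b) by [].
apply/funext => n; rewrite /partial /series /= scaler_sumr -big_split.
apply: eq_bigr => i _; rewrite -[RHS]/(inner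
  (k *: subspace_val a (pr.1 i) + subspace_val b (pr.1 i)) (pr.2 i)).
by rewrite ipDl ipZl.
Qed.

Lemma sw_approx pr (e : K) : 0 < e -> exists N, forall a,
  nr (sw pr a - \sum_(i < N) inner (subspace_val a (pr.1 i)) (pr.2 i) : K[i]^o)
    <= e * nr a.
Proof.
move=> e0; have [N hN] := sw_cauchy pr e0; exists N => a.
rewrite -(big_mkord xpredT (fun i => inner (subspace_val a (pr.1 i)) (pr.2 i))).
rewrite -/(series _ N) nr_distC; apply/ler_addgt0Pr => d d0.
have [N' hN'] := sw_lim pr a d0; pose m := maxn N N'.
rewrite -[X in nr (X - _)](subrK (partial pr a m)) -addrA.
rewrite (le_trans (nrD _ _)) // lerD //.
  by rewrite nr_distC hN // leqnn leq_maxl.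
by rewrite ltW // hN' // leq_maxr.
Qed.

End SigmaWeak.

(** * Normal functionals *)

Section TopologyOfPointwiseConvergence.

Lemma cvg_to_initial (S : choiceType) (T : topologicalType) (w : S -> T)
    (F : set_system S) (x : S) : Filter F ->
  w @ F --> w x -> F --> (x : initial_topology w).
Proof.
move=> FF cw U [? /= [ [B oB <-] ] ] /= Bx /filterS; apply.
by apply: cw; exact: open_nbhs_nbhs.
Qed.

Lemma cvg_ptws (I : Type) (V : topologicalType) (F : set_system (I -> V))
    (f : I -> V) : Filter F ->
  {ptws, F --> f} <-> forall i, (fun g : I -> V => g i) @ F --> f i.
Proof.
move=> FF; split=> [/cvg_sup h i|h].
  apply: cvg_trans (@initial_continuous _ _ (fun g : I -> V => g i) f).
  exact: (@cvg_app _ _ _ _ (fun g : I -> V => g i)) (h i).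
by apply/cvg_sup => i; apply: cvg_to_initial; exact: h.
Qed.

End TopologyOfPointwiseConvergence.

Section NormalFunctionals.
Variables (K : realType) (H : hilbertType K) (M : vonNeumannAlgebra H).
Local Notation E := (vn_elt M).
Local Notation W := (initial_topology (@sigma_weak_eval K H M)).
Implicit Types (a : E) (pr : l2seq H * l2seq H) (s : seq (l2seq H * l2seq H)).

Definition sw_sum s a : K := \sum_(pr <- s) nr (sw pr a).

Lemma sw_sum_ge0 s a : 0 <= sw_sum s a.
Proof. by apply: sumr_ge0 => pr _; apply: nr_ge0. Qed.

Lemma sw_continuous pr : continuous (sw pr : W -> K[i]^o).
Proof.
move=> a; apply: (@continuous_comp W {ptws (l2seq H * l2seq H) -> K[i]^o} _
  (@sigma_weak_eval K H M) (fun g => g pr)).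
  exact: initial_continuous.
pose g := @sigma_weak_eval K H M a : {ptws (l2seq H * l2seq H) -> K[i]^o}.
have gg : {ptws, nbhs g --> g} by move=> U.
exact: ((@cvg_ptws _ K[i]^o (nbhs g) g (nbhs_filter g)).1 gg pr).
Qed.

Lemma sw_sum_near s a (d : K) : 0 < d ->
  nbhs (a : W) [set b : E | sw_sum s (b - a) < d].
Proof.
elim: s d => [|pr s IH] d d0.
  apply: (@filterS _ _ (nbhs_filter (a : W)) setT); last exact: filterT.
  by move=> b _; rewrite /= /sw_sum big_nil.
have d2 := divr_gt0 d0 (ltr0n K 2).
have h1 : nbhs (a : W) [set b : E | nr (sw pr (b - a)) < d / 2].
  have /cvgrPdist_lt/(_ (d / 2)%:C) := @sw_continuous pr a.
  rewrite ltcR => /(_ d2).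
  apply: (@filterS _ _ (nbhs_filter (a : W))) => b /=.
  by rewrite nr_lt (linear_formB _ _ (sw_linear pr)) nr_distC.
have := @filterI _ _ (nbhs_filter (a : W)) _ _ h1 (IH _ d2).
apply: (@filterS _ _ (nbhs_filter (a : W))) => b [/= h3 h4].
by rewrite /sw_sum big_cons (splitr d) ltrD.
Qed.

Lemma sw_sum_cat s1 s2 a : sw_sum (s1 ++ s2) a = sw_sum s1 a + sw_sum s2 a.
Proof. by rewrite /sw_sum big_cat. Qed.

Definition sw_ball (sd : seq (l2seq H * l2seq H) * K) : set E :=
  [set a | sw_sum sd.1 a < sd.2].

(** The neighbourhood filter of the origin for the seminorms [nr (sw pr a)]. It lets
    continuity be converted into a bound by finitely many coordinates without
    unfolding the subbase of the product topology. *)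
Definition sw_filter := filter_from [set sd | 0 < sd.2] sw_ball.

Lemma sw_filter_filter : Filter sw_filter.
Proof.
apply: filter_from_filter; first by exists ([::], 1) => /=.
move=> [s1 d1] [s2 d2] /= h1 h2; exists (s1 ++ s2, Num.min d1 d2) => /=.
  by rewrite lt_min h1 h2.
move=> a; rewrite /sw_ball /= sw_sum_cat lt_min => /andP[k1 k2].
have := sw_sum_ge0 s1 a; have := sw_sum_ge0 s2 a; split=> /=; lra.
Qed.

Lemma sw0 pr : sw pr (0 : E) = 0.
Proof. exact: (linear_form0 (sw_linear pr)). Qed.

Lemma sw_filter_cvg (U : set E) : nbhs (0 : W) U -> sw_filter U.
Proof.
have FF := sw_filter_filter.
suff cv : {ptws, @sigma_weak_eval K H M @ sw_filter --> sigma_weak_eval (0 : E)}.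
  exact: (@cvg_to_initial E {ptws (l2seq H * l2seq H) -> K[i]^o}
    (@sigma_weak_eval K H M) sw_filter 0 FF cv).
apply/cvg_ptws => pr; apply/cvgrPdist_lt => e /posC[r r0 ->].
exists ([:: pr], r) => //= a; rewrite /sw_ball /= /sw_sum big_seq1 => h.
rewrite -[sigma_weak_eval 0 pr]/(sw pr (0 : E)) sw0 sub0r normrN nr_lt.
exact: h.
Qed.

(** A functional continuous at the origin is at most 1 on some [sw_ball], and
    homogeneity turns this into a bound; conversely such a bound controls
    increments, by linearity. In this form normality is easy to transport along
    maps of the algebra. *)
Lemma normal_boundP (z : continuous_dual E) : z \in normal_functional (M := M) <->
  exists (C : K) s, 0 <= C /\ forall a, nr (z a) <= C * sw_sum s a.
Proof.
split=> [/set_mem zc|[C [s [C0 h]]]].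
  have : nbhs (0 : W) [set a : E | nr (z a) < 1].
    have /cvgrPdist_lt/(_ 1%:C) := zc 0; rewrite ltcR => /(_ ltr01).
    apply: (@filterS _ _ (nbhs_filter (0 : W))) => b /=.
    by rewrite bm_0r sub0r normrN nr_lt.
  move=> /sw_filter_cvg[[s d] /= d0 hd]; exists d^-1, s.
  split=> [|a]; first by rewrite invr_ge0 ltW.
  rewrite mulrC ler_pdivlMr //.
  have scale (t : K) : 0 < t -> sw_sum s (t%:C *: a) = t * sw_sum s a.
    move=> t0; rewrite /sw_sum mulr_sumr; apply: eq_bigr => pr _.
    by rewrite (linear_formZ _ _ (sw_linear pr)) nrM nr_real ?ltW.
  rewrite leNgt; apply/negP => h.
  have z0 : 0 < nr (z a).
    by rewrite -(pmulr_lgt0 _ d0) (le_lt_trans (sw_sum_ge0 s a)).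
  have /hd /= : sw_ball (s, d) ((nr (z a))^-1%:C *: a).
    by rewrite /sw_ball /= scale ?invr_gt0 // mulrC ltr_pdivrMr // mulrC.
  rewrite bm_scaler nrM nr_real ?invr_ge0 ?nr_ge0 // mulVf ?ltxx //.
  by rewrite gt_eqF.
apply/mem_set => a; have FF : Filter (nbhs (a : W)) by exact: nbhs_filter.
apply/(@cvgrPdist_lt _ K[i]^o _ _ FF) => e /posC[r r0 ->].
have C1 : 0 < C + 1 by rewrite ltr_wpDl.
have := sw_sum_near s a (divr_gt0 r0 C1).
apply: (@filterS _ _ (nbhs_filter (a : W))) => b /= hb.
rewrite nr_lt nr_distC -bm_subr (le_lt_trans (h _)) //.
rewrite (@le_lt_trans _ _ ((C + 1) * sw_sum s (b - a))) //.
  by rewrite ler_wpM2r ?sw_sum_ge0 ?lerDl.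
by rewrite mulrC -ltr_pdivlMr.
Qed.

Definition vec_sum (t : seq (H * H)) a : K[i] :=
  \sum_(x <- t) inner (subspace_val a x.1) x.2.

Definition vec_approx (z : E -> K[i]) := forall e : K, 0 < e ->
  exists t, forall a, nr (z a - vec_sum t a : K[i]^o) <= e * nr a.

Lemma vec_approx_sw pr : vec_approx (sw pr).
Proof.
move=> e /(sw_approx M pr)[N hN]; exists [seq (pr.1 i, pr.2 i) | i <- index_iota 0 N].
by move=> a; rewrite /vec_sum big_map big_mkord; apply: hN.
Qed.

Lemma vec_approxD (c : K[i]) (y z : E -> K[i]) : vec_approx y -> vec_approx z ->
  vec_approx (fun a => c * y a + z a).
Proof.
move=> hy hz e e0; have e2 := divr_gt0 e0 (ltr0n K 2).
have c1 : 0 < nr (c : K[i]^o) + 1 by rewrite ltr_wpDl ?nr_ge0.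
have [t ht] := hy _ (divr_gt0 e2 c1); have [u hu] := hz _ e2.
exists ([seq (c *: x.1, x.2) | x <- t] ++ u) => a.
rewrite /vec_sum big_cat big_map /=.
have -> : \sum_(x <- t) inner (subspace_val a (c *: x.1)) x.2 = c * vec_sum t a.
  by rewrite mulr_sumr; apply: eq_bigr => x _; rewrite bm_scaler ipZl.
rewrite opprD addrACA -mulrBr (le_trans (@nrD _ K[i]^o _ _)) // (splitr e) mulrDl.
rewrite lerD ?hu // nrM.
rewrite (@le_trans _ _ ((nr (c : K[i]^o) + 1) * (e / 2 / (nr (c : K[i]^o) + 1) * nr a))) //.
  by rewrite ler_pM ?nr_ge0 ?lerDl.
by rewrite mulrA [_ * (e / 2 / _)]mulrC divfK ?gt_eqF.
Qed.

(** By [normal_boundP] the functional vanishes where finitely many coordinates do,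
    so it is a linear combination of them by [span_of_kernel]; each coordinate is
    the norm limit of its partial sums. *)
Lemma normal_approx (z : continuous_dual E) :
  z \in normal_functional (M := M) -> vec_approx z.
Proof.
move=> /normal_boundP[C [s [C0 h]]].
have [||v hv|c hc] := @span_of_kernel _ E _ (sw (M := M)) s z.
- exact: sw_linear.
- by move=> k u v; rewrite bm_addr bm_scaler.
- apply: (@nr_eq0 _ K[i]^o); apply/eqP; rewrite eq_le nr_ge0 andbT.
  suff -> : 0 = C * sw_sum s v by exact: h.
  elim: s hv {h} => [|pr s IH] hv; first by rewrite /sw_sum big_nil mulr0.
  rewrite /sw_sum big_cons hv ?nr0 ?add0r; last by left.
  by apply: IH => i si; apply: hv; right.
have -> : (z : E -> K[i]) = fun a => \sum_(i <- c) i.1 * sw i.2 a by apply/funext.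
elim: c {hc} => [|[k pr] c IH].
  move=> e e0; exists [::] => a; rewrite /vec_sum !big_nil subrr nr0.
  by rewrite mulr_ge0 ?nr_ge0 ?ltW.
under eq_fun do rewrite big_cons.
by apply: vec_approxD => //; apply: vec_approx_sw.
Qed.

Lemma omega_subproof (x y : H) :
  exists w : bounded_map E K[i]^o, forall a, w a = inner (subspace_val a x) y.
Proof.
have l : linear (fun a : E => inner (subspace_val a x) y : K[i]^o).
  by move=> c a b; rewrite /= ipDl ipZl.
have b a : nr (inner (subspace_val a x) y : K[i]^o) <= (nr x * nr y) * nr a.
  rewrite (le_trans (ip_le _ _)) // mulrAC ler_wpM2r ?nr_ge0 // mulrC.
  exact: bm_nr.
by exists (mkbm l b).
Qed.

Lemma sw_single x y a :
  sw (l2_single x, l2_single y) a = inner (subspace_val a x) y.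
Proof.
apply: (lim_to_uniq (sw_lim _ a)) => e e0; exists 1%N => n n1.
rewrite (_ : series _ n = inner (subspace_val a x) y) ?subrr ?nr0 //.
rewrite /series /= big_ltn // big_nat big1 ?addr0 // => -[//|i] _ /=.
by rewrite bm_0r ip0l.
Qed.

Lemma predual_mk (w : continuous_dual E) :
  w \in normal_functional (M := M) -> exists v : predual M, subspace_val v = w.
Proof. by move=> nw; exists (@NormedSubspace _ _ (normal_functional (M := M)) w nw). Qed.

Lemma omega_ex (x y : H) : exists w : predual M,
  forall a, subspace_val w a = inner (subspace_val a x) y.
Proof.
have [w hw] := omega_subproof x y.
have nw : (w : continuous_dual E) \in normal_functional (M := M).
  apply/normal_boundP; exists 1, [:: (l2_single x, l2_single y)]; split=> // a.
  by rewrite /sw_sum big_seq1 sw_single mul1r hw.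
by have [v hv] := predual_mk nw; exists v => a; rewrite hv.
Qed.

End NormalFunctionals.

(** * The dual of the predual *)

Section PredualDual.
Variables (K : realType) (H : hilbertType K) (M : vonNeumannAlgebra H).
Local Notation E := (vn_elt M).
Implicit Types (a : E) (z : predual M).

(** Evaluation of a normal functional, with the two coercions made explicit. *)
Definition ev z a : K[i]^o := (subspace_val z : continuous_dual E) a.

Lemma ev_nr z a : nr (ev z a) <= nr z * nr a.
Proof. exact: bm_nr. Qed.

Lemma evB z a b : ev z (a - b) = ev z a - ev z b.
Proof. exact: bm_subr. Qed.

Lemma evDZ (c : K[i]) z w a : ev (c *: z + w) a = c * ev z a + ev w a.
Proof.
rewrite /ev -[subspace_val (c *: z + w)]/(c *: subspace_val z + subspace_val w).
by rewrite (bmD (c *: _)) bmZ.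
Qed.

Lemma ev_ext z w : (forall a, ev z a = ev w a) -> z = w.
Proof. by move=> h; apply: val_inj; apply: bm_ext. Qed.

Lemma predual_le z (r : K) : 0 <= r -> (forall a, nr (ev z a) <= r * nr a) ->
  nr z <= r.
Proof. by move=> r0 h; apply: (@bm_le _ _ _ (subspace_val z)). Qed.

Lemma ev_approx z : vec_approx (ev z).
Proof. exact: (normal_approx (normed_subspace_subproof z)). Qed.

(** The duality [(M_ * )^* = M]. The values of [f] on vector functionals form a
    bounded sesquilinear form, hence an operator [b]. For [c] in the commutant the
    vector functionals of [(c x, y)] and [(x, c^* y)] agree on the algebra, so [b]
    commutes with [c]. Finite sums of vector functionals are dense in the predual,
    so [f] is evaluation at [b]. *)
Lemma predual_dual_repr (f : continuous_dual (predual M)) :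
  exists b : E, nr b = nr f /\ forall z, f z = ev z b.
Proof.
have /choice[om hom] : forall xy : H * H, exists w : predual M,
    forall a, ev w a = inner (subspace_val a xy.1) xy.2.
  by move=> [x y]; apply: omega_ex.
have nom x y : nr (om (x, y)) <= nr x * nr y.
  apply: predual_le => [|a]; first by rewrite mulr_ge0 ?nr_ge0.
  rewrite hom (le_trans (ip_le _ _)) // mulrAC ler_wpM2r ?nr_ge0 // mulrC.
  exact: bm_nr.
have [||||b hb] := @sesquilinear_repr _ _ (fun x y => f (om (x, y))) (nr f).
- exact: nr_ge0.
- move=> c x y v; have -> : om (c *: x + y, v) = c *: om (x, v) + om (y, v).
    by apply: ev_ext => a; rewrite evDZ !hom bm_addr bm_scaler ipDl ipZl.
  by rewrite bm_addr bm_scaler.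
- move=> c x y v; have -> : om (v, c *: x + y) = (c^*)%R *: om (v, x) + om (v, y).
    by apply: ev_ext => a; rewrite evDZ !hom ipDr ipZr.
  by rewrite bm_addr bm_scaler.
- move=> x y; rewrite (le_trans (bm_nr _ _)) // -mulrA ler_wpM2l ?nr_ge0 //.
have Mb : vn_set M b.
  apply/vn_commuteP => c hc x; apply: ip_ext => y.
  have [d cd] := adjoint_ex c; rewrite hb cd hb.
  congr (f _); apply: ev_ext => a; rewrite !hom /= -cd.
  by rewrite (hc _ (vn_eltP a)).
pose B := vnE Mb.
have fE z : f z = ev z B.
  apply/eqP; rewrite -subr_eq0; apply/eqP.
  apply: (@nr_small _ K[i]^o _ (nr f + nr B)) => e e0.
  have [t ht] := ev_approx z e0.
  have [w [hw fw]] : exists w, (forall a, ev w a = vec_sum t a) /\ f w = vec_sum t B.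
    elim: t {ht} => [|[x y] t [w [hw fw]]].
      by exists 0; split=> [a|]; rewrite /vec_sum big_nil ?bm_0r.
    exists (om (x, y) + w); split=> [a|].
      by rewrite -[om _]scale1r evDZ mul1r hom hw /vec_sum big_cons.
    by rewrite bm_addr fw /vec_sum big_cons -hb.
  have -> : f z - ev z B = f (z - w) - (ev z B - vec_sum t B).
    by rewrite bm_subr fw opprB addrA subrK.
  rewrite (le_trans (nrB _ _)) // mulrDl lerD //; last first.
    by rewrite mulrC; apply: ht.
  rewrite (le_trans (bm_nr _ _)) // ler_wpM2l ?nr_ge0 //.
  apply: predual_le => [|a]; first exact: ltW.
  by rewrite addrC -scaleN1r evDZ hw mulN1r addrC.
exists B; split=> //; apply/eqP; rewrite eq_le; apply/andP; split.
  apply: vn_elt_le => [|x]; first exact: nr_ge0.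
  rewrite -[subspace_val B x]/(b x).
  have [->|bx0] := eqVneq (b x) 0; first by rewrite nr0 mulr_ge0 ?nr_ge0.
  rewrite -(ler_pM2r (nr_gt0 bx0)) -expr2 -ripxx (le_trans (Re_nr _)) // hb.
  by rewrite (le_trans (bm_nr _ _)) // -mulrA ler_wpM2l ?nr_ge0.
apply: bm_le => [|z]; first exact: nr_ge0.
by rewrite fE (le_trans (ev_nr _ _)) // mulrC.
Qed.

End PredualDual.

(** * Complementary corners and the operator *)

Section Corners.
Variables (K : realType) (H : hilbertType K) (M : vonNeumannAlgebra H).
Local Notation E := (vn_elt M).
Variables p q b : bounded_map H H.
Hypotheses (Mp : vn_set M p) (Mq : vn_set M q) (Mb : vn_set M b).
Hypotheses (pp : projection p) (pq : projection q) (b1 : nr b <= 1).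
Hypothesis qb : forall x, q (b (p x)) = b (p x).
Implicit Types (a : E) (z : predual M) (x y : H).

Let Mp' : vn_set M (bid - p) := vn_sub (vn_id M) Mp.
Let Mq' : vn_set M (bid - q) := vn_sub (vn_id M) Mq.

(** [(1 - q) a (1 - p)]. *)
Definition corner a : E := vnE (vn_comp Mq' (vn_comp (vn_eltP a) Mp')).

(** [b p], which is [q b p] here: it lives in the corner complementary to the range
    of [corner]. *)
Definition diag_corner : E := vnE (vn_comp Mb Mp).

Lemma cornerE a x :
  subspace_val (corner a) x =
  subspace_val a (x - p x) - q (subspace_val a (x - p x)).
Proof. by []. Qed.

Lemma diag_cornerE x : subspace_val diag_corner x = b (p x).
Proof. by []. Qed.

Lemma bnr x : nr (b x) <= nr x.
Proof. by rewrite (le_trans (bm_nr _ _)) // ler_piMl ?nr_ge0. Qed.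

Lemma corner_linear : linear corner.
Proof.
move=> c a1 a2; apply: vn_elt_ext => x.
rewrite (vn_eltE c (corner a1)) !cornerE !vn_eltE (bm_addr q) (bm_scaler q) scalerBr.
by rewrite opprD addrACA.
Qed.

Lemma corner_nr a : nr (corner a) <= nr a.
Proof.
apply: vn_elt_le => [|x]; first exact: nr_ge0.
rewrite cornerE (le_trans (projection_nr _ (projection_comp pq))) //.
rewrite (le_trans (bm_nr _ _)) // ler_wpM2l ?nr_ge0 //.
exact: (projection_nr _ (projection_comp pp)).
Qed.

(** Complementary corners have orthogonal ranges and orthogonal initial spaces, so
    by the Pythagorean theorem the norm of a sum is the larger of the two norms. *)
Lemma corner_sum_nr (c d : K[i]) a :
  nr (c : K[i]^o) = 1 -> nr (d : K[i]^o) = nr a ->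
  nr (c *: corner a + d *: diag_corner) <= nr a.
Proof.
move=> c1 d1.
apply: vn_elt_le => [|x]; first exact: nr_ge0.
set u := subspace_val a (x - p x).
have -> : subspace_val (c *: corner a + d *: diag_corner) x =
    c *: (u - q u) + d *: b (p x).
  by rewrite vn_eltE cornerE vn_eltZ diag_cornerE.
apply: nrsq_le; first by rewrite mulr_ge0 ?nr_ge0.
rewrite nrsq_orth; last first.
  rewrite ipZl ipZr ipC -qb projection_orth // conjC0 !mulr0 //.
rewrite exprMn (projection_pyth x pp) mulrDr addrC !nrZ c1 d1 mul1r !exprMn lerD //.
  by rewrite ler_wpM2l ?sqr_ge0 // ler_pXn2r ?nnegrE ?nr_ge0 ?bnr.
rewrite -exprMn ler_pXn2r ?nnegrE ?mulr_ge0 ?nr_ge0 //.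
rewrite (le_trans (projection_nr _ (projection_comp pq))) //.
exact: bm_nr.
Qed.

(** The predual form of [corner_sum_nr]: phases align the two values of [z], whose
    sum is then the value of [z] at one operator of norm at most [nr a]. *)
Lemma corner_additive z a :
  nr (ev z (corner a)) + nr (ev z diag_corner) * nr a <= nr z * nr a.
Proof.
have [c c1 hc] := phase (ev z (corner a)).
have [d d1 hd] := phase (ev z diag_corner).
pose v := c *: corner a + (d * (nr a)%:C) *: diag_corner.
have hv : nr v <= nr a.
  by apply: corner_sum_nr => //; rewrite nrM d1 mul1r nr_real ?nr_ge0.
have <- : nr (ev z v) = nr (ev z (corner a)) + nr (ev z diag_corner) * nr a.
  rewrite -[RHS]nr_real ?addr_ge0 ?mulr_ge0 ?nr_ge0 // rmorphD rmorphM /= -hc -hd.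
  by rewrite /ev /v bm_addr !bm_scaler /= mulrAC.
by rewrite (le_trans (ev_nr _ _)) // ler_wpM2l ?nr_ge0.
Qed.

Lemma sw_corner pr a :
  sw pr (corner a) = sw (l2_map (bid - p) pr.1, l2_map (bid - q) pr.2) a.
Proof.
apply: (lim_to_uniq (sw_lim pr _)).
have := sw_lim (l2_map (bid - p) pr.1, l2_map (bid - q) pr.2) a.
congr (lim_to (series _) _ ); apply/funext => i.
by have [_ h] := projection_comp pq; rewrite -h.
Qed.

Lemma compress_ex z : exists w : predual M, forall a, ev w a = ev z (corner a).
Proof.
have l : linear (fun a => ev z (corner a)).
  by move=> c a1 a2; rewrite corner_linear /ev bm_addr bm_scaler.
have bd a : nr (ev z (corner a)) <= nr z * nr a.
  by rewrite (le_trans (ev_nr _ _)) // ler_wpM2l ?nr_ge0 ?corner_nr.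
have [w hw] : exists w : bounded_map E K[i]^o, forall a, w a = ev z (corner a).
  by exists (mkbm l bd).
have nw : (w : continuous_dual E) \in normal_functional (M := M).
  apply/normal_boundP; have /normal_boundP[C [s [C0 h]]] := normed_subspace_subproof z.
  exists C, [seq (l2_map (bid - p) pr.1, l2_map (bid - q) pr.2) | pr <- s].
  split=> // a; rewrite hw; apply: (le_trans (h (corner a))); rewrite ler_wpM2l //.
  rewrite /sw_sum big_map le_eqVlt; apply/orP; left; apply/eqP.
  by apply: eq_bigr => pr _; rewrite sw_corner.
by have [v hv] := predual_mk nw; exists v => a; rewrite /ev hv hw.
Qed.

(** The compression of [z] to the complementary corner plus a rank-one map in the
    direction [x0]. By [corner_additive] the two summands share the norm of [z]
    instead of adding up; dividing by [beta] costs only a factor [beta^-1]. *)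
Lemma daugavet_operator (beta : K) (x0 : predual M) :
  0 < beta <= 1 -> nr x0 <= 1 ->
  exists T : bounded_map (predual M) (predual M), nr T <= beta^-1 /\
    forall z a, ev (T z) a =
      ev z (corner a) + ev z diag_corner / beta%:C * ev x0 a.
Proof.
move=> /andP[be0 be1] x01; have /choice[P hP] := compress_ex.
have [f fE] : exists f : predual M -> predual M, forall z a, ev (f z) a =
    ev z (corner a) + ev z diag_corner / beta%:C * ev x0 a.
  exists (fun z => (ev z diag_corner / beta%:C) *: x0 + P z) => z a.
  by rewrite evDZ hP addrC.
have lf : linear f.
  move=> c z w; apply: ev_ext => a.
  rewrite fE (evDZ c (f z)) !fE !(evDZ c z w).
  have dist (k u1 u2 v1 v2 m y : K[i]) : k * u1 + u2 + (k * v1 + v2) / m * y =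
    k * (u1 + v1 / m * y) + (u2 + v2 / m * y) by ring.
  exact: dist.
have bi : 0 <= beta^-1 by rewrite invr_ge0 ltW.
have bf z : nr (f z) <= beta^-1 * nr z.
  apply: predual_le => [|a]; first by rewrite mulr_ge0 ?nr_ge0.
  rewrite fE (le_trans (nrD _ _)) // -[leRHS]mulrA.
  apply: (le_trans _ (ler_wpM2l bi (corner_additive z a))).
  rewrite mulrDr lerD //.
    by rewrite ler_peMl ?nr_ge0 // invf_ge1.
  rewrite !nrM -fmorphV /= nr_real // [_ * beta^-1]mulrC -mulrA ler_wpM2l //.
  rewrite ler_wpM2l ?nr_ge0 // (le_trans (ev_nr _ _)) // ler_piMl ?nr_ge0 //.
by exists (mkbm lf bf); split=> [|z a]; [apply: bm_le => // z; exact: bf|exact: fE].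
Qed.

(** On a vector functional the identity
    [(1 - q) a (1 - p) - a = - ((1 - q) a p + q a)] leaves only terms with [p]
    on the right vector or [q] on the left one. The general case follows by
    approximation. *)
Lemma corner_close z t (e d : K) : 0 < e -> 0 <= d ->
  (forall a, nr (ev z a - vec_sum t a : K[i]^o) <= e * nr a) ->
  (forall w, w \in t -> nr (p w.1) <= d /\ nr (q w.2) <= d) ->
  (forall a, nr (ev z (corner a) - ev z a) <=
     (2 * e + d * \sum_(w <- t) (nr w.1 + nr w.2)) * nr a) /\
  nr (ev z diag_corner) <= e + d * \sum_(w <- t) (nr w.1 + nr w.2).
Proof.
move=> e0 d0 ht hpq; split=> [a|].
  rewrite -evB -[X in nr X](subrK (vec_sum t (corner a - a) : K[i]^o)).
  rewrite (le_trans (nrD _ _)) // mulrDl lerD //.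
    rewrite (le_trans (ht _)) // [2 * e]mulrC -mulrA ler_wpM2l ?(ltW e0) //.
    rewrite (le_trans (nrB _ _)) // mulr_natl mulr2n lerD2r.
    exact: corner_nr.
  rewrite (le_trans (@nr_sum _ K[i]^o _ _ _)) // mulr_sumr mulr_suml.
  rewrite big_seq [leRHS]big_seq; apply: ler_sum => -[x y] /hpq [hp hq].
  rewrite -[leLHS]/(nr (inner (subspace_val (corner a - a) x) y : K[i]^o)) /=.
  rewrite -[leLHS]/(nr (inner (subspace_val (corner a - a) x) y : K[i]^o)).
  set A := subspace_val a.
  have -> : subspace_val (corner a - a) x = - ((A (p x) - q (A (p x))) + q (A x)).
    rewrite vn_eltB cornerE -/A !bm_subr.
    rewrite addrAC [A x - A (p x)]addrC addrK [RHS]opprD !opprB.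
    by rewrite addrCA addrA.
  have -> : inner (- (A (p x) - q (A (p x)) + q (A x))) y =
    - (inner (A (p x) - q (A (p x))) y + inner (A x) (q y)).
    by rewrite -pq.2 -ipDl -scaleN1r ipZl mulN1r.
  rewrite (@nrN _ K[i]^o) (le_trans (@nrD _ K[i]^o _ _)) //.
  have nA v : nr (A v) <= nr a * nr v by exact: bm_nr.
  rewrite addrC mulrDr mulrDl lerD //.
    rewrite (le_trans (ip_le _ _)) // -mulrA mulrC [nr x * _]mulrC.
    by rewrite ler_pM ?nr_ge0.
  rewrite (le_trans (ip_le _ _)) // mulrAC ler_wpM2r ?nr_ge0 //.
  rewrite (le_trans (projection_nr _ (projection_comp pq))) //.
  by rewrite (le_trans (nA _)) // mulrC ler_wpM2r ?nr_ge0.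
rewrite -[X in nr X](subrK (vec_sum t diag_corner : K[i]^o)).
rewrite (le_trans (nrD _ _)) // lerD //.
  rewrite (le_trans (ht _)) // ler_piMr ?(ltW e0) //.
  apply: vn_elt_le => // x.
  by rewrite mul1r diag_cornerE (le_trans (bnr _)) // projection_nr.
rewrite (le_trans (@nr_sum _ K[i]^o _ _ _)) // mulr_sumr.
rewrite big_seq [leRHS]big_seq; apply: ler_sum => -[x y] /hpq /= [hp _].
rewrite (le_trans (ip_le _ _)) // (@le_trans _ _ (d * nr y)) //.
  by rewrite ler_wpM2r ?nr_ge0 // (le_trans (bnr _)).
by rewrite ler_wpM2l // lerDr nr_ge0.
Qed.

End Corners.

(** * The operator Daugavet property *)

Theorem theorem7p5 (K : realType) (H : hilbertType K) (M : vonNeumannAlgebra H)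
  (hM : atomless M) : operator_daugavet (predual M).
Proof.
move=> n x _ f alpha f1 al0 eps ep0.
have [B [Bf fB]] := predual_dual_repr f.
have B1 : nr B = 1 by rewrite Bf /nr f1.
pose b := subspace_val B; have Mb : vn_set M b := vn_eltP B.
have b1 : nr b = 1 by exact: B1.
have b1' : nr b <= 1 by rewrite b1.
have [b' Mb' bb'] := vn_star Mb.
have [s [s2 s1 sal sep]] : exists s : K, [/\ 2^-1 <= s, s < 1, 1 - alpha < s &
    s^-1 <= 1 + eps].
  (* only the last two bounds depend on the data; 1/2 keeps [s^-1] bounded by 2
     in the estimates *)
  exists (Num.max (2^-1) (Num.max (1 - alpha / 2) (1 + eps)^-1)).
  have e1 : 0 < 1 + eps by lra.
  split; rewrite ?le_max ?lt_max ?gt_max ?lexx //.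
  - by rewrite invf_lt1 // !invf_lt1 ?ltr1n //; apply/andP; split=> //; lra.
  - by apply/orP; right; apply/orP; left; lra.
  rewrite invf_ple ?posrE //; last by rewrite lt_max invr_gt0 ltr0n.
  by rewrite !le_max lexx !orbT.
have s0 : 0 < s by lra.
have lam1 : 0 <= s ^+ 2 < 1 by rewrite sqr_ge0 expr_lt1 // ltW.
have [e [Me pe e0 he]] := spectral_projection Mb b1 lam1.
pose e1 := eps / 16; have e10 : 0 < e1 by rewrite divr_gt0.
have /choice[t ht] : forall i, exists t, forall a,
    nr (ev (x i) a - vec_sum t a : K[i]^o) <= e1 * nr a.
  by move=> i; apply: ev_approx.
pose C := \sum_(i < n) \sum_(y <- t i) (nr y.1 + nr y.2) + 1.
have Ci0 i : 0 <= \sum_(y <- t i) (nr y.1 + nr y.2).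
  by apply: sumr_ge0 => y _; rewrite addr_ge0 ?nr_ge0.
have Ci i : \sum_(y <- t i) (nr y.1 + nr y.2) <= C.
  rewrite /C (bigD1 i) //= -addrA lerDl addr_ge0 ?ler01 //.
  by apply: sumr_ge0 => j _; exact: Ci0.
have C0 : 0 < C by rewrite /C ltr_wpDl // sumr_ge0.
pose d := e1 / C; have d0 : 0 < d by rewrite divr_gt0.
(* smallness of [p] on [b' y.2] will give smallness of [q] on [y.2]; since
   [1/2 <= s], the target [d / 2] for [p] suffices to reach [d] for [q] *)
pose vs := flatten [seq [seq y.1 | y <- t i] ++ [seq b' y.2 | y <- t i] | i <- enum 'I_n].
have [p [Mp pp p0 ep hp]] := small_projection vs hM Me pe e0 (divr_gt0 d0 (ltr0n K 2)).
have hb v : s ^+ 2 * nr (p v) ^+ 2 <= nr (b (p v)) ^+ 2 by rewrite -ep he.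
have [q [Mq pq qb hq]] := left_support Mb Mp bb' pp (exprn_gt0 2 s0) hb.
rewrite sqrtr_sqr gtr0_norm // in hq.
have hpq i y : y \in t i -> nr (p y.1) <= d /\ nr (q y.2) <= d.
  move=> yt; have h1 : nr (p y.1) < d / 2.
    apply: hp; apply/flattenP; exists ([seq y.1 | y <- t i] ++ [seq b' y.2 | y <- t i]).
      by apply: map_f; rewrite mem_enum.
    by rewrite mem_cat map_f.
  have h2 : nr (p (b' y.2)) < d / 2.
    apply: hp; apply/flattenP; exists ([seq y.1 | y <- t i] ++ [seq b' y.2 | y <- t i]).
      by apply: map_f; rewrite mem_enum.
    by rewrite mem_cat (map_f (fun y => b' y.2)) ?orbT.
  split; first by lra.
  have h3 := hq y.2; have h4 := nr_ge0 (q y.2).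
  have : 2^-1 * nr (q y.2) <= s * nr (q y.2) by rewrite ler_wpM2r.
  lra.
have [v pv] : exists v, p v != 0.
  apply: contrapT => h; move/eqP: p0; apply; apply: bm_ext => v; rewrite bm0.
  by apply/eqP/negPn/negP => hv; apply: h; exists v.
pose k := (nr (p v))^-1; have k0 : 0 < k by rewrite invr_gt0 nr_gt0.
pose xi := k%:C *: p v.
have pxi : p xi = xi by rewrite bm_scaler pp.1.
have xi1 : nr xi = 1 by rewrite nrZr ?(ltW k0) // mulVf // gt_eqF // nr_gt0.
pose be := nr (b xi).
have sbe : s <= be.
  apply: nrsq_le; first exact: nr_ge0.
  by have := hb xi; rewrite pxi xi1 expr1n mulr1.
have be1 : be <= 1 by rewrite /be (le_trans (bm_nr _ _)) // b1 xi1 mul1r.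
have be0 : 0 < be by lra.
(* [b] attains [be], which is at least [s], on this functional, and [p], [q] fix
   its two vectors, so its compression vanishes *)
have [y hy] := omega_ex M xi ((be^-1)%:C *: b xi).
have {}hy a : ev y a = inner (subspace_val a xi) ((be^-1)%:C *: b xi) by exact: hy.
have eta1 : nr ((be^-1)%:C *: b xi) = 1.
  by rewrite nrZr ?invr_ge0 ?nr_ge0 // mulVf // gt_eqF.
have yb : inner (b xi) ((be^-1)%:C *: b xi) = be%:C.
  by rewrite ipZr conj_real ipxx -rmorphM expr2 mulrA mulVf ?mul1r // gt_eqF.
exists y.
  split.
    rewrite -(rmorph1 (real_complex K)) nr_le; apply: predual_le => // a.
    rewrite hy mul1r (le_trans (ip_le _ _)) // eta1 mulr1.
    by rewrite (le_trans (bm_nr _ _)) // xi1 mulr1.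
  by rewrite fB hy yb /=; lra.
move=> x0; rewrite -(rmorph1 (real_complex K)) nr_le => x01.
have beb : 0 < be <= 1 by rewrite be0 be1.
have [T [nT hT]] := daugavet_operator Mp Mq Mb pp pq b1' qb beb x01.
exists T; split.
- rewrite nr_le (le_trans nT) // (le_trans _ sep) // lef_pV2 ?posrE //.
- apply: ev_ext => a; rewrite hT !hy cornerE diag_cornerE pxi subrr !bm_0r subrr.
  rewrite ip0l add0r yb mulfV ?mul1r //.
  by rewrite -(rmorph0 (real_complex K)) (inj_eq (@complexI K)) gt_eqF.
move=> i; rewrite nr_lt.
have [h1 h2] := corner_close Mp Mq Mb pp pq b1' e10 (ltW d0) (ht i) (hpq i).
have dC : d * \sum_(y <- t i) (nr y.1 + nr y.2) <= e1.
  by rewrite (le_trans (ler_wpM2l (ltW d0) (Ci i))) // /d divfK // gt_eqF.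
set S := d * _ in h1 h2 dC.
(* [3 e1] for moving [x i], and [2 e1 / be <= 4 e1] for the rank-one part *)
apply: (@le_lt_trans _ _ (7 * e1)); last by rewrite /e1; lra.
apply: predual_le => [|a]; first by rewrite mulr_ge0 // ltW.
rewrite addrC -scaleN1r evDZ mulN1r addrC hT addrAC.
rewrite (le_trans (nrD _ _)) //.
have -> : 7 * e1 * nr a = 3 * e1 * nr a + 4 * e1 * nr a by ring.
rewrite lerD //.
  by rewrite (le_trans (h1 a)) // ler_wpM2r ?nr_ge0 //; lra.
rewrite !nrM -fmorphV /= nr_real ?invr_ge0 ?nr_ge0 //.
rewrite ler_pM ?mulr_ge0 ?invr_ge0 ?nr_ge0 //; last first.
  by rewrite (le_trans (ev_nr _ _)) // ler_piMl ?nr_ge0.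
rewrite ler_pdivrMr //.
have : 4 * e1 * 2^-1 <= 4 * e1 * be by rewrite ler_pM2l; lra.
lra.
Qed.
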